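(* Let $K$ be a totally real number field. For each of the following five classes of lattices over $K$ — diagonal lattices, classical free lattices, classical lattices, free lattices, and all lattices — there exists a unique inclusion-minimal subset $\mathcal{C}\subset\mathcal{O}_K^+/\mathcal{U}_K^2$ such that every lattice in that class is universal if and only if it is $\mathcal{C}$-universal; denote these sets by $\mathcal{C}^{\mathrm{diag}}_K$, $\mathcal{C}^{\mathrm{cl,fr}}_K$, $\mathcal{C}^{\mathrm{cl}}_K$, $\mathcal{C}^{\mathrm{fr}}_K$, $\mathcal{C}_K$ respectively. Then \[\mathcal{C}^{\mathrm{diag}}_K\subset \mathcal{C}^{\mathrm{cl,fr}}_K= \mathcal{C}^{\mathrm{cl}}_K\subset \mathcal{C}^{\mathrm{fr}}_K=\mathcal{C}_K.\] Moreover, if $\mathcal{C}$ is any of these five sets, $\sigma\in\mathrm{Aut}(K/\mathbb{Q})$ and $\epsilon$ is a totally positive unit of $K$, then $\sigma(\mathcal{C})=\epsilon\cdot\mathcal{C}=\mathcal{C}$.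
   Context: $K$ is a totally real number field, $\mathcal{O}_K$ its ring of integers, $\mathcal{U}_K$ its unit group; $\alpha\succ 0$ means $\sigma(\alpha)>0$ for every real embedding $\sigma$, and $\mathcal{O}_K^+=\{\alpha\in\mathcal{O}_K:\alpha\succ0\}$. $\mathcal{O}_K^+/\mathcal{U}_K^2$ is the set of classes $\alpha\mathcal{U}_K^2$, $\alpha\in\mathcal{O}_K^+$; $\sigma\in\mathrm{Aut}(K/\mathbb{Q})$ acts by $\sigma(\alpha\mathcal{U}_K^2)=\sigma(\alpha)\mathcal{U}_K^2$ and $\epsilon$ acts by multiplication. A lattice over $K$ is a finitely generated torsion-free $\mathcal{O}_K$-module $L$ with a quadratic map $Q:L\to\mathcal{O}_K$ (so $Q(av)=a^2Q(v)$ and $B(v,w)=(Q(v+w)-Q(v)-Q(w))/2$ is bilinear) with $Q(v)\in\mathcal{O}_K^+$ for all $v\neq0$. It is classical if $B(v,w)\in\mathcal{O}_K$ for all $v,w$, and free if $L$ is a free $\mathcal{O}_K$-module. For $a_1,\dots,a_n\in\mathcal{O}_K^+$ the diagonal lattice $\langle a_1,\dots,a_n\rangle$ is $\mathcal{O}_K^n$ with $Q(x)=\sum a_ix_i^2$. $L$ represents $\alpha$ if $\alpha=Q(v)$ for some $v\in L$; for a set $S$ of classes, $L$ is $S$-universal if it represents every element whose class lies in $S$; universal means $\mathcal{O}_K^+/\mathcal{U}_K^2$-universal. *)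

(* Defs.v *)
From HB Require Import structures.
From mathcomp Require Import all_boot all_order all_algebra all_field.
From mathcomp Require Import boolp classical_sets.

Set Implicit Arguments.
Unset Strict Implicit.
Unset Printing Implicit Defensive.

Import Order.TTheory GRing.Theory Num.Theory.

Local Open Scope classical_set_scope.
Local Open Scope ring_scope.

Section IntegerRing.
Variable K : fieldExtType rat.

Definition integral_pred : pred K :=
  fun x => `[< integralOver (intr : int -> K) x >].

Fact integral_subring_closed : subring_closed integral_pred.
Proof.
split=> [|x y|x y]; rewrite /in_mem /= /integral_pred.
- by apply/asboolP; exact: integral1.
- by move=> /asboolP xi /asboolP yi; apply/asboolP; exact: integral_sub.
- by move=> /asboolP xi /asboolP yi; apply/asboolP; exact: integral_mul.
Qed.

HB.instance Definition _ :=
  GRing.isSubringClosed.Build K integral_pred integral_subring_closed.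

Record integers := Integer { int_val :> K; int_valP : integral_pred int_val }.

HB.instance Definition _ := [isSub for int_val].
HB.instance Definition _ := [Choice of integers by <:].
HB.instance Definition _ := [SubChoice_isSubComNzRing of integers by <:].

(* The units of the ring of integers are the elements of the ring whose
   inverse in K is again integral. *)
Definition integers_unit : pred integers :=
  fun x => (val x != 0) && integral_pred (val x)^-1.

Definition integers_inv (x : integers) : integers :=
  if integers_unit x then insubd x (val x)^-1 else x.

Fact integers_mulVx : {in integers_unit, left_inverse 1 integers_inv *%R}.
Proof.
move=> x xU; rewrite /integers_inv.
have -> : integers_unit x by exact: xU.
move: xU => /andP[x0 xi].
by apply: val_inj; rewrite rmorphM rmorph1 /= val_insubd xi mulVf.
Qed.

Fact integers_unitPl (x y : integers) : y * x = 1 -> integers_unit x.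
Proof.
move=> /(congr1 val) /= yx1.
have x0 : int_val x != 0.
  by apply: contra_eq_neq yx1 => ->; rewrite mulr0 eq_sym oner_neq0.
rewrite /integers_unit /= x0 /=.
by rewrite -(mul1r (int_val x)^-1) -yx1 mulfK //; exact: int_valP.
Qed.

Fact integers_inv_out : {in [predC integers_unit], integers_inv =1 id}.
Proof.
move=> x /negbTE xU; rewrite /integers_inv.
by have -> : integers_unit x = false by exact: xU.
Qed.

HB.instance Definition _ := GRing.ComNzRing_hasMulInverse.Build integers
  integers_mulVx integers_unitPl integers_inv_out.

Fact integers_integral_domain : GRing.integral_domain_axiom integers.
Proof.
move=> x y /(congr1 val) /= /eqP.
by rewrite mulf_eq0.
Qed.

HB.instance Definition _ :=
  GRing.ComUnitRing_isIntegral.Build integers integers_integral_domain.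

Fact integral_pred_rmorph (s : {rmorphism K -> K}) (x : integers) :
  integral_pred (s (val x)).
Proof.
apply/asboolP; have /asboolP [p pm pr] := valP x.
exists p => //.
have -> : map_poly (intr : int -> K) p = map_poly s (map_poly intr p).
  rewrite -map_poly_comp; apply: eq_map_poly => z /=.
  by rewrite rmorph_int.
by rewrite /root horner_map (rootP pr) rmorph0.
Qed.

Definition integers_map (s : {rmorphism K -> K}) (x : integers) : integers :=
  Integer (integral_pred_rmorph s x).

End IntegerRing.

Notation "''O_' K" := (integers K)
  (at level 8, K at level 2, format "''O_' K") : type_scope.

Section TotallyReal.
Variable K : fieldExtType rat.

(* K is algebraic over rat, so its complex embeddings land in algC. *)
Definition real_embedding (s : {rmorphism K -> algC}) : Prop :=
  forall x, s x \is Num.real.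

Definition totally_real : Prop :=
  forall s : {rmorphism K -> algC}, real_embedding s.

Definition totally_positive (a : K) : Prop :=
  forall s : {rmorphism K -> algC}, real_embedding s -> 0 < s a.

Definition pos_integers : set 'O_K := [set a | totally_positive (val a)].

Definition sq_class (a : 'O_K) : set 'O_K :=
  [set b | exists2 u : 'O_K, u \is a GRing.unit & b = a * u ^+ 2].

(* The quotient of the totally positive integers by the squares of units; a
   class is represented by the set of its elements. *)
Definition sq_classes : set (set 'O_K) := [set sq_class a | a in pos_integers].

Definition gal_classes (s : {rmorphism K -> K}) (C : set (set 'O_K)) :
    set (set 'O_K) :=
  [set sq_class (integers_map s a) | a in
    [set a | pos_integers a /\ C (sq_class a)]].

Definition mul_classes (e : 'O_K) (C : set (set 'O_K)) : set (set 'O_K) :=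
  [set sq_class (e * a) | a in [set a | pos_integers a /\ C (sq_class a)]].

End TotallyReal.

Section Lattices.
Variable K : fieldExtType rat.

(* The values of the polar form lie in K and need not be integral. *)
Definition polar (L : lmodType 'O_K) (Q : L -> 'O_K) (v w : L) : K :=
  (val (Q (v + w)) - val (Q v) - val (Q w)) / 2%:R.

Definition finitely_generated (L : lmodType 'O_K) : Prop :=
  exists (n : nat) (e : 'I_n -> L),
    forall v : L, exists c : 'rV['O_K]_n, v = \sum_(i < n) c 0 i *: e i.

Definition torsion_free (L : lmodType 'O_K) : Prop :=
  forall (a : 'O_K) (v : L), a *: v = 0 -> a = 0 \/ v = 0.

Definition free_module (L : lmodType 'O_K) : Prop :=
  exists (n : nat) (e : 'I_n -> L),
    forall v : L, exists! c : 'rV['O_K]_n, v = \sum_(i < n) c 0 i *: e i.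

Record lattice := Lattice {
  lat_mod :> lmodType 'O_K;
  lat_form : lat_mod -> 'O_K;
  lat_fg : finitely_generated lat_mod;
  lat_tf : torsion_free lat_mod;
  lat_formZ : forall (a : 'O_K) (v : lat_mod),
    lat_form (a *: v) = a ^+ 2 * lat_form v;
  lat_polarl : forall (a : 'O_K) (u v w : lat_mod),
    polar lat_form (a *: u + v) w
      = val a * polar lat_form u w + polar lat_form v w;
  lat_polarr : forall (a : 'O_K) (u v w : lat_mod),
    polar lat_form w (a *: u + v)
      = val a * polar lat_form w u + polar lat_form w v;
  lat_pos : forall v : lat_mod, v != 0 -> pos_integers (lat_form v)
}.

Definition represents (L : lattice) (a : 'O_K) : Prop :=
  exists v : L, a = lat_form v.

Definition class_universal (S : set (set 'O_K)) (L : lattice) : Prop :=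
  forall a : 'O_K, pos_integers a -> S (sq_class a) -> represents L a.

Definition universal (L : lattice) : Prop := class_universal (@sq_classes K) L.

Section Diagonal.
Variables (n : nat) (a : 'I_n -> 'O_K).
Hypothesis a_pos : forall i, pos_integers (a i).

Definition diag_form (x : 'rV['O_K]_n) : 'O_K :=
  \sum_(i < n) a i * x 0 i ^+ 2.

Fact diag_fg : finitely_generated 'rV['O_K]_n.
Proof. by exists n, (delta_mx 0) => v; exists v; exact: row_sum_delta. Qed.

Fact diag_tf : torsion_free 'rV['O_K]_n.
Proof.
move=> c v cv0; have [->|c0] := eqVneq c 0; [by left|right].
apply/rowP => i; have /rowP/(_ i)/eqP := cv0.
by rewrite !mxE mulf_eq0 (negPf c0) => /eqP.
Qed.

Fact diag_formZ (c : 'O_K) (v : 'rV['O_K]_n) :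
  diag_form (c *: v) = c ^+ 2 * diag_form v.
Proof.
rewrite /diag_form mulr_sumr; apply: eq_bigr => i _.
by rewrite mxE exprMn mulrCA.
Qed.

Fact diag_polarE (v w : 'rV['O_K]_n) :
  polar diag_form v w = \sum_(i < n) val (a i) * val (v 0 i) * val (w 0 i).
Proof.
have n2 : (2%:R : K) != 0.
  by rewrite -(rmorph_nat (in_alg K)) fmorph_eq0 pnatr_eq0.
apply: (canLR (mulfK n2)).
rewrite /diag_form !rmorph_sum -!sumrB mulr_suml; apply: eq_bigr => i _.
rewrite !mxE; move: (a i) (v 0 i) (w 0 i) => b x y /=.
have polarE (p q r : K) :
    p * (q + r) ^+ 2 - p * q ^+ 2 - p * r ^+ 2 = p * q * r * 2%:R.
  rewrite mulr_natr mulr2n sqrrD mulr2n !mulrDr.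
  by rewrite addrAC addrK addrAC subrr add0r !mulrA.
exact: polarE.
Qed.

Fact diag_polarl (c : 'O_K) (u v w : 'rV['O_K]_n) :
  polar diag_form (c *: u + v) w
    = val c * polar diag_form u w + polar diag_form v w.
Proof.
rewrite !diag_polarE mulr_sumr -big_split; apply: eq_bigr => i _ /=.
by rewrite !mxE /= mulrDr mulrDl mulrCA !mulrA [int_val c * _]mulrC -!mulrA.
Qed.

Fact diag_polarr (c : 'O_K) (u v w : 'rV['O_K]_n) :
  polar diag_form w (c *: u + v)
    = val c * polar diag_form w u + polar diag_form w v.
Proof.
have C x y : polar diag_form x y = polar diag_form y x.
  by rewrite /polar [x + y]addrC addrAC.
by rewrite !(C w) diag_polarl.
Qed.

Fact diag_pos (v : 'rV['O_K]_n) : v != 0 -> pos_integers (diag_form v).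
Proof.
move=> v0 s sR.
have [i vi0] : exists i, v 0 i != 0.
  apply/existsP; apply: contraNT v0; rewrite negb_exists => /forallP v0.
  by apply/eqP/rowP => i; rewrite mxE; apply/eqP; rewrite -[_ == _]negbK.
have sE j : s (val (a j * v 0 j ^+ 2)) = s (val (a j)) * s (val (v 0 j)) ^+ 2.
  by rewrite -rmorphXn -rmorphM.
have t_ge0 j : 0 <= s (val (a j * v 0 j ^+ 2)).
  by rewrite sE mulr_ge0 ?(ltW (a_pos j sR)) ?real_exprn_even_ge0.
have t_gt0 : 0 < s (val (a i * v 0 i ^+ 2)).
  rewrite sE mulr_gt0 ?(a_pos i sR) //.
  by rewrite lt_def real_exprn_even_ge0 // andbT expf_neq0 // fmorph_eq0.
rewrite /diag_form !rmorph_sum (bigD1 i) //.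
by apply: ltr_wpDr; [apply: sumr_ge0 => j _; exact: t_ge0 | exact: t_gt0].
Qed.

Definition diag_lattice : lattice :=
  Lattice diag_fg diag_tf diag_formZ diag_polarl diag_polarr diag_pos.

End Diagonal.

Definition diagonal_lattice (L : lattice) : Prop :=
  exists (n : nat) (a : 'I_n -> 'O_K) (ha : forall i, pos_integers (a i)),
    L = diag_lattice ha.

Definition classical_lattice (L : lattice) : Prop :=
  forall v w : L, polar (@lat_form L) v w \in @integral_pred K.

Definition free_lattice (L : lattice) : Prop := free_module L.

Definition classical_free_lattice (L : lattice) : Prop :=
  classical_lattice L /\ free_lattice L.

Definition any_lattice (L : lattice) : Prop := True.

Definition criterion_set (P : lattice -> Prop) (C : set (set 'O_K)) : Prop :=
  C `<=` @sq_classes K /\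
  forall L : lattice, P L -> (universal L <-> class_universal C L).

Definition minimal_criterion_set (P : lattice -> Prop) (C : set (set 'O_K)) :
    Prop :=
  criterion_set P C /\
  forall C', criterion_set P C' -> C' `<=` C -> C' = C.

End Lattices.

(* Main.v *)
(** Call [a] a truant when some lattice of the class represents every totally
    positive integer outside the class of [a] but not [a] itself. A truant
    belongs to every criterion set, so everything reduces to showing that a
    nonuniversal lattice [L] misses a truant. Take [a] missed by [L] of minimal
    norm, and add to [L] a diagonal lattice that represents the other missed
    classes but has only coefficients of norm at least [norm a]; a value of the
    sum equal to [a] would force a coefficient in the class of [a].

    Such a diagonal lattice of finite rank exists by elementary means. By
    pigeonhole (Minkowski, then finiteness of principal ideals of bounded norm)
    a unit [u] makes the conjugates of [b * u ^+ 2] comparable. A balanced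
    integer of large size is [n * c + \sum_k r_k * w_k] with [n] and [r_k]
    natural numbers, [c] in a finite set and [w] a fixed finite family spanning
    the integers over [int]; Lagrange's four squares theorem then makes it a
    value of the diagonal form with every [c] and [w_k] repeated four times.

    A lattice [L] with [n] generators is replaced by a free one by projectivity:
    with [p] the projection from ['rV_n] to [L] and [P] an idempotent integral
    matrix with image [ker p], the form [Q (p c) + N * |c *m P| ^ 2] on ['rV_n]
    represents the values of [L], and its other values are large. The matrix [P]
    comes from the invertibility of ideals, proved from Dedekind's Prague
    theorem. Automorphisms and totally positive units act by transporting
    lattices. *)

From HB Require Import structures.
Require Import Defs.
From mathcomp Require Import all_boot all_order all_algebra all_field.
From mathcomp Require Import boolp classical_sets.
From mathcomp Require Import zify ring lra.

Set Implicit Arguments.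
Unset Strict Implicit.
Unset Printing Implicit Defensive.

Import Order.TTheory GRing.Theory Num.Theory.

Local Open Scope ring_scope.

Notation Zintegral := (integralOver intr).

(** * Integral elements of a field and denominators *)

Section IntegralElements.
Variable F : fieldType.
Implicit Types (h : {poly F}) (r : F).

(** Multiplying [h(r) = 0] by a power of the leading coefficient [c] turns it into a monic equation
    for [c * r]. *)
Lemma integral_lead_root h r :
  (forall i, Zintegral h`_i) -> root h r -> Zintegral (lead_coef h * r).
Proof.
move=> hI hr; have [->|h0] := eqVneq h 0.
  by rewrite lead_coef0 mul0r; exact: integral0.
set c := lead_coef h; set n := (size h).-1.
have szh : size h = n.+1 by rewrite polySpred.
have [n0|n_gt0] := posnP n.
  have /size_poly1P [a a0 ha] : size h == 1%N by rewrite szh n0.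
  by move: hr; rewrite ha rootC (negPf a0).
(* This is [c ^+ n.-1 * h] rewritten in the variable [c * X]. Its coefficients are only integral,
   not integers, which still makes its roots integral. *)
pose q := 'X^n + \poly_(i < n) (h`_i * c ^+ (n.-1 - i)).
have qm : q \is monic.
  by rewrite monicE lead_coefDl ?lead_coefXn // size_polyXn ltnS size_poly.
have cI : Zintegral c by exact: hI.
have XI k : Zintegral (c ^+ k).
  by elim: k => [|k IH]; [exact: integral1 | rewrite exprS; exact: integral_mul].
apply: (integral_root_monic qm).
  rewrite rootE /q hornerD hornerXn horner_poly.
  have := rootP hr; rewrite horner_coef szh big_ord_recr /=.
  move=> /(congr1 ( *%R (c ^+ n.-1))); rewrite mulr0 mulrDr mulr_sumr => hr0.
  apply/eqP; rewrite -[RHS]hr0 addrC; congr (_ + _); last first.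
    by rewrite exprMn mulrA -[in c ^+ n](prednK n_gt0) exprSr.
  apply: eq_bigr => i _; rewrite exprMn.
  have -> : c ^+ n.-1 = c ^+ (n.-1 - i) * c ^+ i.
    by rewrite -exprD subnK // -ltnS prednK.
  by ring.
apply/integral_poly => i; rewrite /q coefD coefXn coef_poly.
apply: integral_add; first exact: integral_nat.
by case: ifP => _; [exact: integral_mul | exact: integral0].
Qed.

Lemma integral_prod I (s : seq I) (P : pred I) (E : I -> F) :
  (forall i, P i -> Zintegral (E i)) -> Zintegral (\prod_(i <- s | P i) E i).
Proof.
move=> EI; elim/big_rec: _ => [|i x Pi xI]; first exact: integral1.
exact: integral_mul (EI i Pi) xI.
Qed.

Lemma integral_sum I (s : seq I) (P : pred I) (E : I -> F) :
  (forall i, P i -> Zintegral (E i)) -> Zintegral (\sum_(i <- s | P i) E i).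
Proof.
move=> EI; elim/big_rec: _ => [|i x Pi xI]; first exact: integral0.
exact: integral_add (EI i Pi) xI.
Qed.

Lemma integral_morph (E : fieldType) (f : {rmorphism F -> E}) (x : F) :
  Zintegral (f x) <-> Zintegral x.
Proof.
have mapE (p : {poly int}) : map_poly intr p = map_poly f (map_poly intr p).
  by rewrite -map_poly_comp; apply: eq_map_poly => z /=; rewrite rmorph_int.
by split=> -[p pm pr]; exists p => //; move: pr; rewrite mapE fmorph_root.
Qed.

End IntegralElements.

Lemma integral_ratr (x : rat) :
  Zintegral (ratr x : algC) -> exists n : int, x = n%:~R.
Proof.
case=> p pm pr; suff : (ratr x : algC) \in Num.int.
  by rewrite Cint_rat => /intrP [n ->]; exists n.
apply: Cint_rat_Aint; first exact: Crat_rat.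
apply: root_monic_Aint pr _ _; first exact: monic_map.
by apply/polyOverP => i; rewrite coef_map /= intr_int.
Qed.

Section PrimitiveElement.
Variable K : fieldExtType rat.

(** The minimal polynomial with its denominators cleared is an integer polynomial, and its leading
    coefficient times [x] is integral by [integral_lead_root]. *)
Lemma integral_multiple (x : K) :
  exists2 m : nat, (0 < m)%N & Zintegral (m%:R * x).
Proof.
have /polyOver1P [p pE] := minPolyOver 1%AS x.
have px : root (map_poly (in_alg K) p) x by rewrite -pE root_minPoly.
have p0 : p != 0.
  by rewrite -(map_poly_eq0 (in_alg K)) -pE monic_neq0 // monic_minPoly.
have [q [a a0 pq]] := rat_poly_scale p.
have q0 : q != 0 by apply: contra_neq p0 => q0; rewrite pq q0 rmorph0 scaler0.
have qx : root (map_poly intr q) x.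
  move: px; rewrite pq linearZ /= -map_poly_comp.
  rewrite rootZ; last by rewrite scaler_eq0 oner_eq0 orbF invr_eq0 intr_eq0.
  by congr root; apply: eq_map_poly => z; exact: (rmorph_int (in_alg K)).
have := integral_lead_root _ qx.
have -> : lead_coef (map_poly intr q) = (lead_coef q)%:~R :> K.
  apply: lead_coef_map_eq.
  have : (in_alg K (lead_coef q)%:~R) != 0.
    by rewrite fmorph_eq0 intr_eq0 lead_coef_eq0.
  by rewrite rmorph_int.
move=> H; exists `|lead_coef q|%N; first by rewrite absz_gt0 lead_coef_eq0.
have qI : Zintegral ((lead_coef q)%:~R * x).
  by apply: H => i; rewrite coef_map; exact: integral_id.
(* The leading coefficient may be negative, so its sign is moved into the integral element. *)
have := @intEsign (lead_coef q); case: (lead_coef q < 0) => /= E.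
  rewrite E expr1 in qI; have := integral_opp qI.
  by rewrite mulN1r rmorphN /= mulNr opprK.
by rewrite E mul1r in qI.
Qed.

(** Characteristic zero gives a separable generator, and a positive integer multiple of it is
    integral and generates the same field. *)
Lemma integral_primitive_element :
  exists z : 'O_K, (<<1; val z>>%AS : {vspace K}) = fullv.
Proof.
have sep : separable 1 {:K}.
  apply/separableP => y _; apply: pcharf0_separable => p.
  by rewrite pchar_lalg pchar_num.
have := eq_adjoin_separable_generator sep (sub1v _).
set z0 := separable_generator _ _ => z0E.
have [m m0 zI] := integral_multiple z0.
have zI' : @integral_pred K (m%:R * z0) by apply/asboolP.
exists (Integer zI') => /=; apply/eqP; rewrite eqEsubv subvf /= [fullv]z0E.
apply/FadjoinP; split; first exact: subv_adjoin.
have mK : (m%:R : K) != 0.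
  by rewrite -(rmorph_nat (in_alg K)) fmorph_eq0 pnatr_eq0 -lt0n.
suff : (m%:R^-1 * (m%:R * z0)) \in <<1; m%:R * z0>>%VS by rewrite mulKf.
by rewrite rpredM ?memv_adjoin // rpredV rpred_nat.
Qed.

End PrimitiveElement.

(** * Real embeddings and rationality of the norm *)

Section Embeddings.
Variable K : fieldExtType rat.

(** The embeddings take values in the ordered field [algR] rather than in [algC], so that conjugates
    can be compared without side conditions on realness. The powers of the integral element [gen]
    form a rational basis of [K]. *)
Record embedding_data := EmbeddingData {
  deg : nat;
  deg_gt0 : (0 < deg)%N;
  gen : 'O_K;
  sig : 'I_deg -> {rmorphism K -> algR};
  sig_all : forall s : {rmorphism K -> algC},
    exists i, forall x, s x = algRval (sig i x);
  gen_span : forall x : K, exists c : 'I_deg -> rat,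
    x = \sum_(k < deg) ratr (c k) * val gen ^+ k;
  gen_free : forall c : 'I_deg -> rat,
    \sum_(k < deg) ratr (c k) * val gen ^+ k = 0 -> forall k, c k = 0;
  norm_rat : forall x : K, exists q : rat, \prod_(i < deg) sig i x = ratr q
}.

(** Every element is a polynomial in [z]; replacing [z] by [r] is well defined because [f] divides
    any rational polynomial that vanishes at [z]. *)
Lemma rmorph_of_root (z : K) (f : {poly rat}) (r : algC) :
    (<<1; z>>%AS : {vspace K}) = fullv -> minPoly 1 z = map_poly (in_alg K) f ->
    root (map_poly ratr f) r ->
  exists s : {rmorphism K -> algC}, s z = r.
Proof.
move=> zfull fE fr.
pose ev (p : {poly rat}) : K := (map_poly (in_alg K) p).[z].
pose evr (p : {poly rat}) : algC := (map_poly ratr p).[r].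
have evP x : exists p, x = ev p.
  by apply/Fadjoin1_polyP; rewrite zfull memvf.
have ev0 p : ev p = 0 -> evr p = 0.
  move=> p0; have : f %| p.
    rewrite -(dvdp_map (in_alg K)) -fE minPoly_dvdp //; last exact/rootP.
    by apply/polyOver1P; exists p.
  move=> /dvdpP [q ->]; rewrite /evr rmorphM hornerM (rootP fr) mulr0 //.
have evB p q : ev (p - q) = ev p - ev q by rewrite /ev rmorphB hornerD hornerN.
have evM p q : ev (p * q) = ev p * ev q by rewrite /ev rmorphM hornerM.
have evrB p q : evr (p - q) = evr p - evr q by rewrite /evr rmorphB hornerD hornerN.
have evrM p q : evr (p * q) = evr p * evr q by rewrite /evr rmorphM hornerM.
have evI p q : ev p = ev q -> evr p = evr q.
  by move/eqP; rewrite -subr_eq0 -evB => /eqP/ev0/eqP; rewrite evrB subr_eq0 => /eqP.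
(* A polynomial expression of [x] in [z] is chosen; by [evI] its value at [r] does not depend on the
   choice. *)
pose P x := xget 0 [set p | x = ev p]%classic.
have PE x : ev (P x) = x.
  by have [p xp] := evP x; rewrite /P; case: xgetP => [q _ ->|/(_ p)].
pose g x := evr (P x).
have gA : zmod_morphism g.
  by move=> x y; rewrite /g -evrB; apply: evI; rewrite evB !PE.
have gM : monoid_morphism g.
  split=> [|x y]; last by rewrite /g -evrM; apply: evI; rewrite evM !PE.
  transitivity (evr 1); last by rewrite /evr rmorph1 hornerC.
  by apply: evI; rewrite PE /ev rmorph1 hornerC.
pose hA := GRing.isZmodMorphism.Build K algC g gA.
pose hM := GRing.isMonoidMorphism.Build K algC g gM.
exists (HB.pack g hA hM : {rmorphism K -> algC}) => /=.
transitivity (evr 'X); last by rewrite /evr map_polyX hornerX.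
by apply: evI; rewrite PE /ev map_polyX hornerX.
Qed.

Lemma real_rmorph (s : {rmorphism K -> algC}) :
  real_embedding s -> exists t : {rmorphism K -> algR}, forall x, s x = algRval (t x).
Proof.
move=> sR; pose g x := in_algR (sR x).
have gA : zmod_morphism g by move=> x y; apply: val_inj; rewrite /= rmorphB.
have gM : monoid_morphism g.
  by split=> [|x y]; apply: val_inj; rewrite /= ?rmorph1 ?rmorphM.
pose hA := GRing.isZmodMorphism.Build K algR g gA.
pose hM := GRing.isMonoidMorphism.Build K algR g gM.
by exists (HB.pack g hA hM : {rmorphism K -> algR}).
Qed.

(** The minimal polynomial of an integral generator has distinct roots in [algC], one embedding for
    each, and total reality brings these embeddings into [algR]. *)
Lemma embedding_data_exists : totally_real K -> inhabited embedding_data.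
Proof.
move=> hK; have [z zfull] := integral_primitive_element K.
have /polyOver1P [f fE] := minPolyOver 1%AS (val z).
set n := adjoin_degree 1%AS (val z).
have szf : size f = n.+1.
  by rewrite -(size_map_poly (in_alg K)) -fE size_minPoly.
have fm : f \is monic by rewrite -(map_monic (in_alg K)) -fE monic_minPoly.
have sepf : separable_poly f.
  have : separable_element 1 (val z).
    by apply: pcharf0_separable => p; rewrite pchar_lalg pchar_num.
  by rewrite /separable_element fE separable_map.
have [rs] := closed_field_poly_normal (map_poly (ratr : rat -> algC) f).
rewrite lead_coef_map (monicP fm) rmorph1 scale1r => rsE.
have rsU : uniq rs.
  by rewrite -separable_prod_XsubC -rsE separable_map.
have szrs : size rs = n.
  apply: succn_inj; rewrite -szf -(size_map_poly (ratr : {rmorphism rat -> algC})).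
  by rewrite rsE size_prod_XsubC.
have ratrE (y : K) (c : rat) : c *: y = ratr c * y.
  by rewrite -alg_num_field -scalerAl mul1r.
have span x : exists c : 'I_n -> rat, x = \sum_(k < n) ratr (c k) * val z ^+ k.
  have /polyOver1P [p pE] := Fadjoin_polyOver 1%AS (val z) x.
  exists (fun k => p`_k).
  rewrite -[LHS](@Fadjoin_poly_eq _ _ 1%AS (val z)); last by rewrite zfull memvf.
  rewrite (@horner_coef_wide _ n); last exact: size_Fadjoin_poly.
  by apply: eq_bigr => k _; rewrite pE coef_map /= -scalerAl mul1r ratrE.
have free (c : 'I_n -> rat) :
    \sum_(k < n) ratr (c k) * val z ^+ k = 0 -> forall k, c k = 0.
  move=> c0.
  pose p := \poly_(i < n) (if insub i is Some k then c k else 0).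
  have pk (k : 'I_n) : p`_k = c k by rewrite coef_poly ltn_ord valK.
  suff p0 : p = 0 by move=> k; rewrite -pk p0 coef0.
  apply/eqP; rewrite -(map_poly_eq0 (in_alg K)).
  rewrite -(@root_small_adjoin_poly _ _ 1%AS (val z)).
  - rewrite rootE (@horner_coef_wide _ n) ?size_map_poly ?size_poly //.
    rewrite -[X in _ == X]c0; apply/eqP/eq_bigr => k _.
    by rewrite coef_map pk /= -scalerAl mul1r ratrE.
  - by apply/polyOver1P; exists p.
  - by rewrite size_map_poly size_poly.
have [s sP] : exists s : 'I_n -> {rmorphism K -> algR},
    forall i, algRval (s i (val z)) = rs`_i.
  apply: (@fin_all_exists _ _ (fun (i : 'I_n) (s : {rmorphism K -> algR}) =>
    algRval (s (val z)) = rs`_i)) => i.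
  have ri : root (map_poly ratr f) rs`_i.
    by rewrite rsE root_prod_XsubC mem_nth // szrs.
  have [t tz] := rmorph_of_root zfull fE ri.
  by have [u uE] := real_rmorph (hK t); exists u; rewrite -uE.
have sinj i j : s i (val z) = s j (val z) -> i = j.
  move=> /(congr1 algRval); rewrite !sP => /eqP.
  by rewrite nth_uniq ?szrs // => /eqP/val_inj.
have n_gt0 : (0 < n)%N by rewrite /n.
have all (t : {rmorphism K -> algC}) : exists i, forall x, t x = algRval (s i x).
  have : root (map_poly ratr f) (t (val z)).
    have := root_minPoly 1%AS (val z); rewrite fE -(fmorph_root t) -map_poly_comp.
    by congr (root _ _); apply: eq_map_poly => c /=; rewrite alg_num_field fmorph_rat.
  rewrite rsE root_prod_XsubC => /(nthP 0) [i]; rewrite szrs => ilt iE.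
  exists (Ordinal ilt) => x; have [c ->] := span x.
  pose u : {rmorphism K -> algC} := algRval \o s (Ordinal ilt).
  have uz : t (val z) = u (val z) by have := sP (Ordinal ilt); rewrite /= iE => <-.
  rewrite -[RHS]/(u _) !rmorph_sum; apply: eq_bigr => k _.
  by rewrite [t _]rmorphM [u _]rmorphM !rmorphXn uz !fmorph_rat.
suff norm x : exists q : rat, \prod_(i < n) s i x = ratr q.
  exact: inhabits (EmbeddingData n_gt0 all span free norm).
(* The rational matrix [M] of multiplication by [x] is diagonalised by the Vandermonde matrix of the
   conjugates of [z], with the conjugates of [x] on the diagonal; hence their product is
   [\det M]. *)
have /fin_all_exists [c cE] (k : 'I_n) := span (x * val z ^+ k).
pose M := \matrix_(k < n, l < n) c k l.
pose V := Vandermonde n (\row_(j < n) s j (val z)).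
have V0 : \det V != 0.
  rewrite det_Vandermonde; apply/prodf_neq0 => i _; apply/prodf_neq0 => j ij.
  rewrite !mxE subr_eq0; apply: contraTneq ij => /sinj ->.
  by rewrite ltnn.
have MV : map_mx ratr M *m V = V *m diag_mx (\row_j s j x).
  apply/matrixP => k j; rewrite mul_mx_diag !mxE.
  rewrite mulrC -rmorphXn -rmorphM cE rmorph_sum.
  by apply: eq_bigr => l _; rewrite !mxE [RHS]rmorphM rmorphXn fmorph_rat.
exists (\det M).
move/(congr1 determinant): MV; rewrite !det_mulmx det_diag mulrC => /(mulfI V0).
rewrite det_map_mx => ->; apply: eq_bigr => i _.
by rewrite mxE.
Qed.

End Embeddings.

(** * Sums of four squares *)

Section FourSquares.

Definition four_sq (n : int) :=
  exists a b c d : int, n = a ^+ 2 + b ^+ 2 + c ^+ 2 + d ^+ 2.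

(** Euler's four-square identity. *)
Lemma four_sqM m n : four_sq m -> four_sq n -> four_sq (m * n).
Proof.
move=> [a [b [c [d ->]]]] [x [y [z [t ->]]]].
exists (a * x + b * y + c * z + d * t), (a * y - b * x + c * t - d * z),
  (a * z - c * x + d * y - b * t), (a * t - d * x + b * z - c * y).
by ring.
Qed.

Lemma balanced_residue (m a : int) : 0 < m ->
  exists k r : int, a = r + m * k /\ - m <= 2 * r <= m.
Proof.
(* The quotient [a / m] rounded to a nearest integer, as the floor of [a / m + 1 / 2]. *)
move=> m0; pose k := ((2 * a + m) %/ (2 * m))%Z.
have m2 : 0 < 2 * m by lia.
exists k, (a - m * k); split; first by ring.
have := divz_eq (2 * a + m) (2 * m); rewrite -/k.
have := modz_ge0 (2 * a + m) (lt0r_neq0 m2).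
have := ltz_pmod (2 * a + m) m2.
set u := (_ %% _)%Z; move=> h1 h2 h3.
have -> : 2 * (a - m * k) = u - m by lia.
by apply/andP; split; lia.
Qed.

(** With [h = (p - 1) / 2], the [h + 1] squares [x ^+ 2] and the [h + 1] values [- 1 - y ^+ 2] for
    [x, y <= h] cannot be disjoint in a field of [p] elements. The bounds on [x] and [y] also give
    [m < p]. *)
Lemma sq_add_sq_mod (p : nat) : prime p -> odd p ->
  exists x y m : int, [/\ x ^+ 2 + y ^+ 2 + 1 = m * p%:Z, 0 < m & m < p%:Z].
Proof.
move=> pp po; pose h := p./2.
have pE : p = (h.*2).+1 by rewrite -[LHS]odd_double_half po.
have chp : p \in [char 'F_p] by exact: pchar_Fp.
have inj : injective (fun i : 'I_h.+1 => (i%:R : 'F_p) ^+ 2).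
  have aux (i j : nat) : (i <= j)%N -> (j < h.+1)%N ->
      (i%:R : 'F_p) ^+ 2 = j%:R ^+ 2 -> i = j.
    move=> ij jh /eqP; rewrite eq_sym -subr_eq0 subr_sqr -natrB // -natrD.
    rewrite mulf_eq0 -!(dvdn_pcharf chp) => /orP [] /dvdnP [q].
      case: q => [|q] E; first by lia.
      by have : (p <= j - i)%N by [rewrite E mulSn leq_addr]; lia.
    case: q => [|q] E; first by lia.
    by have : (p <= j + i)%N by [rewrite E mulSn leq_addr]; lia.
  move=> i j /= E; apply: val_inj; case: (leqP i j) => ij.
    exact: aux ij (ltn_ord j) E.
  exact/esym/(aux _ _ (ltnW ij) (ltn_ord i) (esym E)).
pose A := [set (i%:R : 'F_p) ^+ 2 | i : 'I_h.+1].
pose B := [set - 1 - (i%:R : 'F_p) ^+ 2 | i : 'I_h.+1].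
have cA : #|A| = h.+1 by rewrite card_imset // card_ord.
have cB : #|B| = h.+1.
  rewrite card_imset ?card_ord // => i j /= /addrI/oppr_inj; exact: inj.
have : A :&: B != finset.set0.
  rewrite -card_gt0; have := cardsUI A B; rewrite cA cB.
  have : (#|A :|: B| <= p)%N.
    by rewrite (leq_trans (max_card _)) // card_Fp.
  by lia.
case/finset.set0Pn => w; rewrite inE => /andP [/imsetP [x _ wx] /imsetP [y _]].
rewrite {}wx => /eqP; rewrite -subr_eq0 => /eqP E.
have : (p %| x ^ 2 + y ^ 2 + 1)%N.
  rewrite (dvdn_pcharf chp) !natrD !natrX; apply/eqP; rewrite -[RHS]E.
  by ring.
case/dvdnP => m mE; exists x%:Z, y%:Z, m%:Z.
have mE' : (x%:Z ^+ 2 + y%:Z ^+ 2 + 1 = m%:Z * p%:Z).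
  by rewrite -PoszM -mE !PoszD !expr2 !PoszM.
have xh : (x <= h)%N by rewrite -ltnS.
have yh : (y <= h)%N by rewrite -ltnS.
split => //; first by case: m mE {mE'} => //; lia.
have h0 : (0 < h)%N by move: (prime_gt1 pp); lia.
have : (x ^ 2 + y ^ 2 + 1 < p * p)%N.
  have : (x ^ 2 <= h ^ 2)%N by rewrite leq_exp2r.
  have : (y ^ 2 <= h ^ 2)%N by rewrite leq_exp2r.
  rewrite pE; nia.
by rewrite mE ltn_pmul2r ?prime_gt0 // => mp; lia.
Qed.

Lemma sq_le_of_half (M u : int) : - M <= 2 * u <= M -> 4 * u ^+ 2 <= M ^+ 2.
Proof.
move=> /andP [h1 h2]; rewrite -subr_ge0.
have -> : M ^+ 2 - 4 * u ^+ 2 = (M - 2 * u) * (M + 2 * u) by ring.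
by apply: mulr_ge0; lia.
Qed.

Lemma eq_half_of_sq (M u : int) : 4 * u ^+ 2 = M ^+ 2 -> 2 * u = M \/ 2 * u = - M.
Proof.
move=> h; have : (2 * u - M) * (2 * u + M) = 0.
  transitivity (4 * u ^+ 2 - M ^+ 2); [by ring | by rewrite h subrr].
move/eqP; rewrite mulf_eq0 subr_eq0 addr_eq0.
by case/orP => /eqP; [left|right].
Qed.

Lemma sum4_eq0 (u v w t : int) : 0 <= u -> 0 <= v -> 0 <= w -> 0 <= t ->
  u + v + w + t = 0 -> [/\ u = 0, v = 0, w = 0 & t = 0].
Proof. by move=> *; split; lia. Qed.

Lemma sum4_le (u v w t M : int) : 4 * u <= M -> 4 * v <= M -> 4 * w <= M ->
  4 * t <= M -> u + v + w + t <= M /\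
  (u + v + w + t = M -> [/\ 4 * u = M, 4 * v = M, 4 * w = M & 4 * t = M]).
Proof. by move=> *; split=> [|?]; last split; lia. Qed.

(** Lagrange's descent: a representation of [m * p] with [1 < m < p] yields one of [r * p] with
    [0 < r < m]. *)
Lemma four_sq_descent (p : nat) (m : nat) :
  prime p -> (0 < m < p)%N -> four_sq (m%:Z * p%:Z) -> four_sq p%:Z.
Proof.
move=> pp; have [k] := ubnP m; elim: k m => // k IH m; rewrite ltnS => mk.
move=> /andP [m0 mp] [a [b [c [d E]]]].
have [m1|m1] := eqVneq m 1%N.
  by exists a, b, c, d; rewrite -E m1 mul1r.
have ndvd t : p%:Z <> m%:Z * t.
  move=> pt; have : (m %| p)%N.
    by apply/dvdnP; exists `|t|%N; rewrite -[p]/(`|p%:Z|%N) pt abszM mulnC.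
  by move/(prime_nt_dvdP pp m1) => mpE; rewrite mpE ltnn in mp.
have mZ : 0 < m%:Z by lia.
have mZ0 : m%:Z != 0 by lia.
have [ka [ra [aE aB]]] := balanced_residue a mZ.
have [kb [rb [bE bB]]] := balanced_residue b mZ.
have [kc [rc [cE cB]]] := balanced_residue c mZ.
have [kd [rd [dE dB]]] := balanced_residue d mZ.
pose M := m%:Z.
(* Solving for the sum of the squared residues in [m * p = \sum (residue + m * quotient) ^+ 2] shows
   that it equals [m * r] for this [r]. *)
pose r := p%:Z - 2 * (ra * ka + rb * kb + rc * kc + rd * kd)
  - M * (ka ^+ 2 + kb ^+ 2 + kc ^+ 2 + kd ^+ 2).
have rE : ra ^+ 2 + rb ^+ 2 + rc ^+ 2 + rd ^+ 2 = M * r.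
  by rewrite /r mulrBr mulrBr [M * p%:Z]E aE bE cE dE /M; ring.
have r0 : 0 <= r.
  have : 0 <= M * r by rewrite -rE !addr_ge0 ?sqr_ge0.
  by rewrite pmulr_rge0.
have [sle seq] := sum4_le (sq_le_of_half aB) (sq_le_of_half bB)
  (sq_le_of_half cB) (sq_le_of_half dB).
have rM : r <= M.
  have : M * r <= M * M by rewrite -rE -expr2.
  by rewrite ler_pM2l.
have mK : injective ( *%R M) by exact: mulfI.
(* If [r = 0], all residues vanish, so [m ^+ 2] divides [m * p] and [m] divides the prime [p]. *)
have [rr|rr] := eqVneq r 0.
  move: rE; rewrite rr mulr0 => rE.
  have [] := sum4_eq0 (sqr_ge0 _) (sqr_ge0 _) (sqr_ge0 _) (sqr_ge0 _) rE.
  move=> /eqP; rewrite sqrf_eq0 => /eqP ra0 /eqP; rewrite sqrf_eq0 => /eqP rb0.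
  move=> /eqP; rewrite sqrf_eq0 => /eqP rc0 /eqP; rewrite sqrf_eq0 => /eqP rd0.
  case: (ndvd (ka ^+ 2 + kb ^+ 2 + kc ^+ 2 + kd ^+ 2)); apply: mK.
  by rewrite [LHS]E aE bE cE dE ra0 rb0 rc0 rd0 /M; ring.
(* If [r = m], every residue is [m / 2] up to sign. Each square then changes by a multiple of
   [m ^+ 2] on passing to its residue, and the residues' squares add up to [m ^+ 2], so again [m]
   divides [p]. *)
have [rr'|rr'] := eqVneq r M.
  move: rE; rewrite rr' -expr2 => rE.
  have step (u : int) k' : 4 * u ^+ 2 = M ^+ 2 ->
      exists t, (u + M * k') ^+ 2 = u ^+ 2 + M ^+ 2 * t.
    case/eq_half_of_sq => h.
      exists (k' + k' ^+ 2); have -> : M ^+ 2 * (k' + k' ^+ 2) = (2 * u) * M * k' + M ^+ 2 * k' ^+ 2 by rewrite h; ring.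
      by ring.
    exists (- k' + k' ^+ 2); have -> : M ^+ 2 * (- k' + k' ^+ 2) = (2 * u) * M * k' + M ^+ 2 * k' ^+ 2 by rewrite h; ring.
    by ring.
  have [ea eb ec ed] := seq rE.
  have [ta taE] := step ra ka ea; have [tb tbE] := step rb kb eb.
  have [tc tcE] := step rc kc ec; have [td tdE] := step rd kd ed.
  case: (ndvd (1 + ta + tb + tc + td)); apply: mK.
  rewrite [LHS]E aE bE cE dE -/M taE tbE tcE tdE.
  transitivity (ra ^+ 2 + rb ^+ 2 + rc ^+ 2 + rd ^+ 2 + M ^+ 2 * (ta + tb + tc + td)).
    by ring.
  by rewrite rE; ring.
have [n rn] : exists n : nat, r = n by exists `|r|%N; rewrite gez0_abs.
have nm : (0 < n < m)%N.
  move: rr rr' rM; rewrite rn /M eqz_nat eqz_nat lez_nat -lt0n => -> nm nlem.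
  by rewrite ltn_neqAle nm.
have /andP [n0 ltnm] := nm.
apply: (IH n); [exact: leq_trans ltnm _ | by rewrite n0 (ltn_trans ltnm mp) |].
(* Euler's identity for [(a, b, c, d)] and its residues produces four multiples of [m]; these are
   the quotients by [m]. *)
exists (r + (ka * ra + kb * rb + kc * rc + kd * rd)),
  (ka * rb - kb * ra + kc * rd - kd * rc),
  (ka * rc - kc * ra + kd * rb - kb * rd),
  (ka * rd - kd * ra + kb * rc - kc * rb).
rewrite -rn; apply: (mK); apply: (mK).
transitivity ((M * r) * (m%:Z * p%:Z)); first by rewrite /M; ring.
rewrite E aE bE cE dE -/M.
transitivity ((M * r + M * (ka * ra + kb * rb + kc * rc + kd * rd)) ^+ 2
  + M ^+ 2 * ((ka * rb - kb * ra + kc * rd - kd * rc) ^+ 2 +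
  (ka * rc - kc * ra + kd * rb - kb * rd) ^+ 2 +
  (ka * rd - kd * ra + kb * rc - kc * rb) ^+ 2)); last by ring.
by rewrite -rE; ring.
Qed.

(** Strong induction, splitting off the smallest prime factor. For an odd prime the descent starts
    from [x ^+ 2 + y ^+ 2 + 1 ^+ 2 + 0 ^+ 2 = m * p]. *)
Lemma four_squares (n : nat) : exists f : 'I_4 -> int, n%:Z = \sum_i f i ^+ 2.
Proof.
suff [a [b [c [d E]]]] : four_sq n.
  exists (fun i : 'I_4 => nth 0 [:: a; b; c; d] i).
  by rewrite !big_ord_recr big_ord0 /= add0r.
have [k] := ubnP n; elim: k n => // k IH n; rewrite ltnS => nk.
have [n2|n2] := leqP n 1.
  case: n n2 {nk} => [|[|//]] _; first by exists 0, 0, 0, 0.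
  by exists 1, 0, 0, 0.
have pp := pdiv_prime n2; set p := pdiv n in pp.
have FSp : four_sq p.
  have [p2|po] := even_prime pp; first by rewrite p2; exists 1, 1, 0, 0.
  have [x [y [m [E m0 mp]]]] := sq_add_sq_mod pp po.
  have [q qE] : exists q : nat, m = q by exists `|m|%N; lia.
  apply: (@four_sq_descent p q) => //; first by lia.
  by rewrite -qE -E; exists x, y, 1, 0; ring.
have /dvdnP [q qE] := pdiv_dvd n.
rewrite qE PoszM; apply: four_sqM => //; apply: IH.
have q0 : (0 < q)%N by case: q qE => // ; lia.
by apply: leq_trans nk; rewrite qE ltn_Pmulr // prime_gt1.
Qed.

End FourSquares.

(** * Geometry of numbers *)

Lemma nat_bound (R : archiRealFieldType) (T : finType) (f : T -> R) :
  exists n : nat, forall x, f x <= n%:R.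
Proof.
exists (\sum_x (Num.trunc (f x)).+1)%N => x.
apply: (le_trans (ltW (truncnS_gt (f x)))).
by rewrite ler_nat (bigD1 x) //= leq_addr.
Qed.

(** The pigeonhole principle in the form used for finiteness: one representative in [A] is kept for
    each code attained on [A]. *)
Lemma code_representatives (T : choiceType) (I : finType) (A : T -> Prop)
    (code : T -> I) :
  exists s : seq T, (forall y, y \in s -> A y) /\
    forall x, A x -> exists2 y, y \in s & code x = code y.
Proof.
suff [s [sA sP]] : exists s : seq T, (forall y, y \in s -> A y) /\
    forall x, A x -> code x \in enum I -> exists2 y, y \in s & code x = code y.
  by exists s; split=> // x Ax; apply: sP; rewrite ?mem_enum.
elim: (enum I) => [|c l [s [sA sP]]]; first by exists [::].
have [[z [Az zc]]|none] := pselect (exists z, A z /\ code z = c).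
  exists (z :: s); split=> [y|x Ax]; rewrite inE.
    by case/orP => [/eqP ->|/sA].
  case/orP => [/eqP xc|/(sP x Ax) [y ys xy]].
    by exists z; rewrite ?mem_head // xc.
  by exists y => //; rewrite inE ys orbT.
exists s; split=> // x Ax; rewrite inE => /orP [/eqP xc|]; last exact: sP.
by case: none; exists x.
Qed.

Lemma algR_root (n : nat) (x : algR) : (0 < n)%N -> 0 < x ->
  exists2 y : algR, 0 < y & y ^+ n = x.
Proof.
move=> n0 x0; have xC : 0 < algRval x by [].
have yP : 0 < n.-root (algRval x) by rewrite rootC_gt0.
exists (in_algR (gtr0_real yP)) => //.
by apply: val_inj; rewrite rmorphXn /= rootCK.
Qed.

Section Geometry.
Variables (K : fieldExtType rat) (E : embedding_data K).
Local Notation d := (deg E).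
Implicit Types x y : 'O_K.

Definition emb (i : 'I_d) : {rmorphism 'O_K -> algR} := sig i \o (val : 'O_K -> K).

Lemma emb_eq0 i x : (emb i x == 0) = (x == 0).
Proof. by rewrite /= fmorph_eq0. Qed.

Lemma emb_inj i x y : emb i x = emb i y -> x = y.
Proof.
by move/eqP; rewrite -subr_eq0 -rmorphB emb_eq0 subr_eq0 => /eqP.
Qed.

Lemma pos_integersP x : pos_integers x <-> forall i, 0 < emb i x.
Proof.
split=> [xP i|xP s _].
  pose s : {rmorphism K -> algC} := algRval \o sig i.
  have := xP s (fun t => algRvalP _).
  by [].
by have [i ->] := sig_all E s; exact: xP.
Qed.

Definition norm x : algR := \prod_i emb i x.

Lemma normM x y : norm (x * y) = norm x * norm y.
Proof. by rewrite /norm -big_split; apply: eq_bigr => i _; rewrite rmorphM. Qed.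

(** The norm is rational and integral, hence an integer. The quotient [norm x / x] is integral
    because one embedding sends it to the product of the other conjugates. *)
Lemma norm_cofactor x : x != 0 ->
  exists (n : int) (y : 'O_K), norm x = n%:~R /\ x * y = n%:~R.
Proof.
move=> x0; have [q qE] := norm_rat E (val x).
have embI i : Zintegral (sig i (val x)).
  by apply/integral_morph/asboolP; exact: (valP x).
have [n nE] : exists n : int, q = n%:~R.
  apply: integral_ratr; rewrite -(fmorph_rat algRval) -qE.
  by apply/integral_morph/integral_prod => i _; exact: embI.
have NE : norm x = n%:~R by rewrite /norm qE nE ratr_int.
have yI : @integral_pred K (n%:~R / val x).
  apply/asboolP; apply/(integral_morph (sig (Ordinal (deg_gt0 E)))).
  set i0 := Ordinal _.
  rewrite fmorph_div rmorph_int /= -NE /norm (bigD1 i0) //= mulrC mulKf.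
    by apply: integral_prod => i _; exact: embI.
  by rewrite fmorph_eq0.
exists n, (Integer yI); split=> //; apply: val_inj.
by rewrite rmorphM rmorph_int /= mulrC mulfVK.
Qed.

Lemma norm_ge1 x : x != 0 -> 1 <= `|norm x|.
Proof.
move=> x0; have [n [y [NE _]]] := norm_cofactor x0.
rewrite NE -intr_norm -[1]/(1%:~R) ler_int.
have : norm x != 0.
  by apply/prodf_neq0 => i _; rewrite emb_eq0.
by rewrite NE intr_eq0; lia.
Qed.

Lemma norm_unit x : norm x ^+ 2 = 1 -> x \is a GRing.unit.
Proof.
move=> N1; have x0 : x != 0.
  apply: contra_eq_neq N1 => ->.
  rewrite /norm (bigD1 (Ordinal (deg_gt0 E))) //= rmorph0 mul0r expr0n.
  by rewrite eq_sym oner_eq0.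
have [n [y [NE xy]]] := norm_cofactor x0.
move: N1; rewrite NE -rmorphXn -[1]/(1%:~R) => /intr_inj n1.
apply/unitrPr; exists (y * n%:~R); rewrite mulrA xy.
by rewrite -rmorphM -expr2 n1.
Qed.

(** Two such elements whose conjugates have the same integer parts differ by an element with all
    conjugates below [1] in absolute value; its norm is below [1], so it is zero. *)
Lemma finite_bounded (C : algR) :
  exists s : seq 'O_K, forall x, (forall i, `|emb i x| <= C) -> x \in s.
Proof.
have [M ME] : exists M : nat, 2%:R * C < M%:R.
  by exists (Num.trunc (2%:R * C)).+1; exact: truncnS_gt.
pose A x := forall i, `|emb i x| <= C.
(* Adding [C] makes the conjugates nonnegative, where [Num.trunc] is the floor. *)
pose code x := [ffun i : 'I_d => inord (Num.trunc (emb i x + C)) : 'I_M.+1].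
have [s [sA sP]] := code_representatives A code.
exists s => x xA; have [y ys xy] := sP x xA; have yA := sA y ys.
suff -> : x = y by [].
apply/eqP; rewrite -subr_eq0; apply/negPn/negP => /norm_ge1.
apply/negP; rewrite -ltNge /norm normr_prod.
have lt1 i : `|emb i (x - y)| < 1.
  have bnd z : A z -> 0 <= emb i z + C < M%:R.
    by move=> /(_ i); rewrite ler_norml => /andP [h1 h2]; apply/andP; split; lra.
  have tr z : A z -> (Num.trunc (emb i z + C) < M.+1)%N.
    move=> zA; have /andP [h1 h2] := bnd z zA.
    by rewrite ltnS ltnW // truncn_lt_nat.
  have := congr1 (fun f : {ffun 'I_d -> 'I_M.+1} => val (f i)) xy.
  rewrite !ffunE /= !inordK ?tr // => tE.
  have /andP [hx _] := bnd x xA; have /andP [hy _] := bnd y yA.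
  have := truncn_itv hx; have := truncn_itv hy; rewrite tE rmorphB ltr_norml.
  move=> /andP [a1]; rewrite -natr1 => a2 /andP [b1 b2].
  by apply/andP; split; lra.
rewrite (bigD1 (Ordinal (deg_gt0 E))) //=.
apply: le_lt_trans (lt1 (Ordinal (deg_gt0 E))).
rewrite ler_piMr ?normr_ge0 //; apply: prodr_ile1 => i _.
by rewrite normr_ge0 (ltW (lt1 i)).
Qed.

(** Removing the integer parts of the coordinates in the power basis leaves an integer with bounded
    conjugates, hence one of a finite list. The powers and this list therefore span; adding a large
    integer to each makes all conjugates large. *)
Lemma integral_span (B : nat) : exists (I : finType) (w : I -> 'O_K),
  (forall k i, B%:R <= emb i (w k)) /\
  forall x, exists c : I -> int, x = \sum_k (c k)%:~R * w k.
Proof.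
pose z := gen E.
have [S SP] := nat_bound (fun i : 'I_d => \sum_(k < d) `|emb i (z ^+ k)|).
have [F0 F0P] := finite_bounded S%:R.
pose J := ('I_d + 'I_(size F0))%type.
pose v (j : J) := match j with inl k => z ^+ k | inr j => F0`_j end.
have [M MP] := nat_bound (fun p : J * 'I_d => B%:R - emb p.2 (v p.1)).
(* The shift [B + M] is itself the member [None], so that shifts can be undone within the span. *)
pose w (k : option J) : 'O_K := if k is Some j then v j + (B + M)%:R else (B + M)%:R.
exists (option J), w; split=> [[j|] i|x].
- rewrite rmorphD rmorph_nat natrD.
  have := MP (j, i) => /= MP1; have : 0 <= B%:R :> algR by exact: ler0n.
  by move: MP1; set u := (sig _ _) => *; lra.
- by rewrite rmorph_nat ler_nat leq_addr.
have [c cE] := gen_span E (val x).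
pose a k := Num.floor (c k).
pose r := x - \sum_(k < d) (a k)%:~R * z ^+ k.
have rF : r \in F0.
  apply: F0P => i; apply: le_trans (SP i).
  have -> : emb i r = \sum_(k < d) ratr (c k - (a k)%:~R) * emb i (z ^+ k).
    rewrite /r rmorphB rmorph_sum /= [sig i (\val x)](_ : _ =
      \sum_(k < d) ratr (c k) * emb i (z ^+ k)); last first.
      rewrite cE rmorph_sum; apply: eq_bigr => k _.
      by rewrite [LHS]rmorphM fmorph_rat /= rmorphXn [val (z ^+ k)]rmorphXn rmorphXn.
    rewrite -sumrB; apply: eq_bigr => k _.
    have -> : ratr (c k - (a k)%:~R) = ratr (c k) - (a k)%:~R :> algR.
      by have := rmorphB (ratr : {rmorphism rat -> algR}) (c k) (a k)%:~R; rewrite /= ratr_int.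
    rewrite mulrBl; congr (_ - _).
    transitivity (emb i ((a k)%:~R * z ^+ k)); first by [].
    by rewrite rmorphM rmorph_int.
  apply: (le_trans (ler_norm_sum _ _ _)); apply: ler_sum => k _.
  rewrite normrM ler_piMl ?normr_ge0 // ger0_norm.
    have -> : (1 : algR) = ratr 1 by rewrite rmorph1.
    rewrite ler_rat.
    by have := ltW (floorD1_gt (c k)); rewrite intrD /a; lra.
  by rewrite ler0q subr_ge0 floor_le.
have jlt : (index r F0 < size F0)%N by rewrite index_mem.
(* The coefficient of [None] cancels one shift for each power counted by [a] and one for the
   remainder [r]. *)
pose e (k : option J) : int := match k with
  | None => - (\sum_(k < d) a k + 1)
  | Some (inl k) => a k | Some (inr j) => (j == Ordinal jlt)%:R end.
exists e.
have big_opt (f : option J -> 'O_K) :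
    \sum_k f k = f None + (\sum_(k < d) f (Some (inl k)) + \sum_j f (Some (inr j))).
  rewrite (bigD1 None) //= (reindex_omap Some id) /=; last by case.
  by congr (_ + _); rewrite (eq_bigl xpredT) ?big_sumType //= => j; exact: eqxx.
rewrite big_opt /= [X in _ + (_ + X)](bigD1 (Ordinal jlt)) //= eqxx.
rewrite [X in _ + (_ + (_ + X))]big1 ?addr0; last first.
  by move=> j /negPf ->; rewrite mul0r.
rewrite mul1r nth_index // /r.
under [X in _ + (X + _)]eq_bigr do rewrite mulrDr.
rewrite big_split /= -mulr_suml rmorphN rmorphD rmorph_sum /=.
by ring.
Qed.

End Geometry.

(** * Minkowski's theorem by pigeonhole *)

Section Units.
Variables (K : fieldExtType rat) (E : embedding_data K).
Local Notation d := (deg E).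
Local Notation emb := (@emb K E).
Implicit Types x y : 'O_K.

Lemma prod_geD1 (I : finType) (f : I -> algR) (C : algR) (j : I) :
  (forall i, 0 < f i <= C) -> \prod_i f i <= f j * C ^+ #|I|.-1.
Proof.
move=> fC; have C0 : 0 < C by have /andP [h1 h2] := fC j; exact: lt_le_trans h1 h2.
rewrite (bigD1 j) //= ler_wpM2l //; first by have /andP [/ltW] := fC j.
rewrite -(cardC1 j) -prodr_const; apply: ler_prod => i _.
by have /andP [/ltW -> ->] := fC i.
Qed.

(** Among the combinations of the power basis with coefficients in [0, ..., m], two must lie in the
    same box of sides [t i], and their difference is the required element. The constant is not
    optimal, but it does not depend on [t]. *)
Lemma minkowski : exists2 S : nat, (0 < S)%N &
  forall t : 'I_d -> algR, (forall i, 0 < t i) -> S%:R ^+ d <= \prod_i t i ->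
    exists2 x : 'O_K, x != 0 & forall i, `|emb i x| <= t i.
Proof.
pose z := gen E.
have [S0 S0P] := nat_bound (fun i : 'I_d => \sum_(k < d) `|emb i (z ^+ k)|).
pose S := S0.+1.
have SP i : \sum_(k < d) `|emb i (z ^+ k)| <= S%:R.
  by apply: le_trans (S0P i) _; rewrite ler_nat leqnSn.
exists (4 * S)%N => // t t0 tS.
(* Choosing [m] above every [t i] keeps each side of the box below the bound [Y] on the
   conjugates. *)
have [m0 m0P] := nat_bound t; pose m := m0.+1.
have tm i : t i <= m%:R by apply: le_trans (m0P i) _; rewrite ler_nat leqnSn.
pose X (c : {ffun 'I_d -> 'I_m.+1}) : 'O_K := \sum_(k < d) (c k)%:R * z ^+ k.
pose Y : algR := m%:R * S%:R.
have XB c i : `|emb i (X c)| <= Y.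
  rewrite /X rmorph_sum; apply: le_trans (ler_norm_sum _ _ _) _.
  apply: (@le_trans _ _ (\sum_(k < d) m%:R * `|emb i (z ^+ k)|)).
    apply: ler_sum => k _; rewrite rmorphM rmorph_nat normrM normr_nat.
    by rewrite ler_wpM2r ?normr_ge0 // ler_nat -ltnS.
  by rewrite -mulr_sumr ler_wpM2l.
pose b i := Num.trunc (2%:R * Y / t i).
pose tr c i := Num.trunc ((emb i (X c) + Y) / t i).
have Y_ge0 c i : 0 <= (emb i (X c) + Y) / t i.
  apply: divr_ge0; last exact: ltW.
  by have := XB c i; rewrite ler_norml; lra.
have trb c i : (tr c i <= b i)%N.
  apply: le_truncn; rewrite ler_pM2r ?invr_gt0 //.
  by have := XB c i; rewrite ler_norml; lra.
pose code (c : {ffun 'I_d -> 'I_m.+1}) : {dffun forall i : 'I_d, 'I_(b i).+1} :=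
  [ffun i => inord (tr c i)].
have codeE c i : code c i = tr c i :> nat.
  by rewrite ffunE inordK // ltnS.
have : ~~ injectiveb code.
  apply/negP => /injectiveP inj; have := leq_card code inj.
  rewrite card_ffun !card_ord card_dep_ffun foldrE big_image /=.
  under eq_bigr do rewrite card_ord.
  apply/negP; rewrite -ltnNge -(ltr_nat algR) natr_prod natrX.
  have m_gt0 : 0 < m%:R :> algR by rewrite ltr0n.
  have S_ge1 : 1 <= S%:R :> algR by rewrite ler1n.
  apply: (@le_lt_trans _ _ (m%:R ^+ d)); last first.
    by rewrite ltrXn2r ?ltr_nat ?ler0n // -lt0n deg_gt0.
  (* Since [t i <= Y], the count [b i + 1 <= 2 * Y / t i + 1] is at most [4 * Y / t i]. The product
     over [i] is then at most [m ^+ d], fewer than the [(m + 1) ^+ d] combinations. *)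
  apply: (@le_trans _ _ (\prod_i (4%:R * Y / t i))).
    apply: ler_prod => i _; rewrite ler0n /=.
    have Yt : t i <= Y.
      by apply: le_trans (tm i) _; rewrite /Y ler_peMr // ltW.
    rewrite -natr1; apply: (@le_trans _ _ (2%:R * Y / t i + 1)).
      rewrite lerD2r; have : 0 <= 2%:R * Y / t i.
        by rewrite divr_ge0 ?(ltW (t0 i)) // mulr_ge0 ?ler0n // (le_trans _ Yt) // ltW.
      by move=> h; have /andP [] := truncn_itv h.
    rewrite -[X in _ + X](divff (lt0r_neq0 (t0 i))) -mulrDl ler_pM2r ?invr_gt0 //.
    by have := t0 i; lra.
  rewrite big_split /= prodfV prodr_const card_ord.
  rewrite ler_pdivrMr; last exact: prodr_gt0.
  apply: (@le_trans _ _ (m%:R ^+ d * (4 * S)%:R ^+ d)).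
    by rewrite -exprMn natrM /Y mulrCA.
  by rewrite ler_wpM2l // exprn_ge0 // ltW.
case/injectivePn => c1 [c2 c12 cE].
exists (X c1 - X c2).
  apply: contra_neq c12 => X0; apply/ffunP => k; apply/val_inj/eqP.
  rewrite -(eqr_nat rat) -subr_eq0; apply/eqP; move: k.
  apply: (gen_free (e := E)).
  have := congr1 val X0; rewrite rmorphB !rmorph_sum -sumrB rmorph0 => X0'.
  rewrite -[RHS]X0'; apply: eq_bigr => k _.
  rewrite -alg_num_field scalerBl !scaler_nat mulrBl.
  transitivity (val ((c1 k)%:R * z ^+ k) - val ((c2 k)%:R * z ^+ k)) => //.
  by rewrite !rmorphM !rmorph_nat rmorphXn.
move=> i.
have tE : tr c1 i = tr c2 i by rewrite -!codeE cE.
have := truncn_itv (Y_ge0 c1 i); have := truncn_itv (Y_ge0 c2 i).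
rewrite -/(tr c1 i) -/(tr c2 i) tE.
rewrite !ler_pdivlMr // !ltr_pdivrMr // -!natr1 !mulrDl mul1r.
move=> /andP [h1 h2] /andP [h3 h4].
by rewrite rmorphB ler_norml; apply/andP; split; lra.
Qed.

End Units.

(** * Elements of bounded norm and balancing by units *)

Section BalancedUnits.
Variables (K : fieldExtType rat) (E : embedding_data K).
Local Notation d := (deg E).
Local Notation emb := (@emb K E).
Local Notation norm := (@norm K E).
Implicit Types x y : 'O_K.

(** A nonzero element of norm at most [C] divides its norm and hence [C!]. So two such elements
    congruent modulo [C!] divide each other, and there are finitely many residues. *)
Lemma unit_representatives (C : nat) : exists s : seq 'O_K,
  (forall y, y \in s -> y != 0) /\
  forall x, x != 0 -> `|norm x| <= C%:R ->
    exists (y u : 'O_K), [/\ y \in s, u \is a GRing.unit & x = u * y].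
Proof.
have [I [w [_ wspan]]] := integral_span E 0.
have [c cE] := choice wspan.
pose m : nat := C`!.
have m0 : (m%:Z != 0) by rewrite eqz_nat -lt0n fact_gt0.
pose A x := x != 0 /\ `|norm x| <= C%:R.
pose code x := [ffun k : I => inord `|(c x k %% m%:Z)%Z|%N : 'I_m.+1].
have [s [sA sP]] := code_representatives A code.
exists s; split=> [y /sA []//|x x0 xC].
have [y ys xy] := sP x (conj x0 xC); have [y0 yC] := sA y ys.
have [t tE] : exists t, x - y = m%:R * t.
  exists (\sum_k ((c x k - c y k) %/ m%:Z)%Z%:~R * w k).
  rewrite [in LHS](cE x) [in LHS](cE y) -sumrB mulr_sumr; apply: eq_bigr => k _.
  rewrite -mulrBl mulrA -rmorphB; congr (_ * _).
  have -> : m%:R = (m%:Z)%:~R :> 'O_K by [].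
  rewrite -rmorphM mulrC divzK //.
  rewrite -eqz_mod_dvd; apply/eqP.
  have := congr1 (fun f : {ffun I -> 'I_m.+1} => val (f k)) xy.
  have lt z : (`|(z %% m%:Z)%Z| < m.+1)%N.
    by have := ltz_mod z m0; have := modz_ge0 z m0; lia.
  rewrite !ffunE /= !inordK //.
  by have := modz_ge0 (c x k) m0; have := modz_ge0 (c y k) m0; lia.
have dvd z : A z -> exists q, m%:R = z * q.
  move=> [z0 zC]; have [n [q [nE zq]]] := norm_cofactor E z0.
  have := norm_ge1 E z0; move: zC; rewrite nE -intr_norm => h1 h2.
  have n1 : (0 < `|n| <= C)%N.
    by move: h1 h2; rewrite -[C%:R]/(C%:Z%:~R) -[1]/(1%:~R) !ler_int; lia.
  have /dvdnP [l lE] : (`|n| %| m)%N by exact: dvdn_fact.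
  (* The norm may be negative; [e] is its sign. *)
  pose e : int := (-1) ^+ (n < 0)%R; exists (q * (l%:Z * e)%:~R).
  have ee : e * e = 1 by rewrite -expr2 sqrr_sign.
  rewrite mulrA zq -rmorphM /=; have -> : m%:R = (m%:Z)%:~R :> 'O_K by [].
  congr (_ %:~R); rewrite lE PoszM.
  have ne : n = e * `|n|%N by exact: intEsign.
  transitivity (l%:Z * `|n|%N * (e * e)); first by rewrite ee mulr1.
  by rewrite [X in _ = X * _]ne; ring.
have [qx qxE] := dvd x (conj x0 xC).
have [qy qyE] := dvd y (conj y0 yC).
have xE : x = y * (1 + qy * t) by rewrite mulrDr mulr1 mulrA -qyE -tE; ring.
have yE : y = x * (1 - qx * t) by rewrite mulrBr mulr1 mulrA -qxE -tE; ring.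
exists y, (1 + qy * t); split => //; last by rewrite mulrC.
apply/unitrPr; exists (1 - qx * t); apply: (mulfI y0).
by rewrite mulrA -xE mulr1.
Qed.

(** Minkowski's theorem with sides proportional to the inverse square roots of the conjugates of [a]
    gives [x] of bounded norm for which [a * x ^+ 2] is balanced. Up to a unit [u], [x] is one of
    finitely many [y], and replacing [x] by [u] changes the ratios by a bounded factor. *)
Lemma balanced_unit : exists R : nat, forall a : 'O_K, pos_integers a ->
  exists2 u : 'O_K, u \is a GRing.unit &
    forall i j, emb i (a * u ^+ 2) <= R%:R * emb j (a * u ^+ 2).
Proof.
have [S S0 mink] := minkowski E.
have [s [s0 sP]] := unit_representatives (S ^ d).
(* The power of [S] bounds the ratios for [a * x ^+ 2]; the squared quotients account for passing
   from [x = u * y] to [u]. *)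
have [R RP] := nat_bound (fun p : 'I_(size s) * 'I_d * 'I_d =>
  S%:R ^+ (d.*2) * (emb p.1.2 s`_p.1.1 / emb p.2 s`_p.1.1) ^+ 2).
exists R => a /(pos_integersP E) aP.
have S_gt0 : 0 < S%:R :> algR by rewrite ltr0n.
(* [nu] is the geometric mean of the conjugates of [a], and [t] is chosen so that
   [emb i a * t i ^+ 2 = S ^+ 2 * nu] for every [i]; this makes the product of the [t i] exactly
   [S ^+ d]. *)
have [nu nu0 nuE] : exists2 nu : algR, 0 < nu & nu ^+ d = norm a.
  by apply: algR_root; [exact: deg_gt0 | exact: prodr_gt0].
have /fin_all_exists2 [t t0 tE] (i : 'I_d) :
    exists2 y : algR, 0 < y & y ^+ 2 = S%:R ^+ 2 * nu / emb i a.
  apply: algR_root => //; apply: divr_gt0 => //; apply: mulr_gt0 => //.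
  exact: exprn_gt0.
have tprod : \prod_i t i = S%:R ^+ d.
  apply/eqP; rewrite -(@eqrXn2 _ 2) //; last 2 first.
  - by apply: prodr_ge0 => i _; exact: ltW.
  - by rewrite exprn_ge0 // ltW.
  rewrite -prodrXl (eq_bigr _ (fun i _ => tE i)) big_split /= prodfV.
  have -> : \prod_i emb i a = nu ^+ d by rewrite nuE.
  rewrite prodr_const card_ord exprMn mulfK; last first.
    by rewrite expf_neq0 // lt0r_neq0.
  by rewrite -!exprM mulnC.
have [|x x0 xt] := mink t t0; first by rewrite tprod.
have normx : `|norm x| <= (S ^ d)%:R.
  rewrite natrX -tprod -[norm x]/(\prod_i emb i x) normr_prod; apply: ler_prod => i _.
  by rewrite normr_ge0 xt.
have [y [u [ys uU xE]]] := sP x x0 normx.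
have u0 : u != 0 by apply: contraTneq uU => ->; rewrite unitr0.
exists u => // i j.
pose f i := emb i (a * x ^+ 2).
have fP k : 0 < f k <= S%:R ^+ 2 * nu.
  rewrite /f rmorphM rmorphXn mulr_gt0 ?aP //=; last first.
    by rewrite lt_def expf_neq0 ?emb_eq0 // sqr_ge0.
  have -> : S%:R ^+ 2 * nu = emb k a * t k ^+ 2.
    by rewrite tE mulrCA divff ?mulr1 // lt0r_neq0 // aP.
  rewrite ler_wpM2l ?(ltW (aP k)) // -real_normK ?num_real //.
  by rewrite lerXn2r ?nnegrE ?normr_ge0 ?(ltW (t0 k)) // xt.
(* All conjugates of [a * x ^+ 2] are at most [S ^+ 2 * nu] while their product is at least
   [nu ^+ d], so none of them can be small. *)
have low : nu ^+ d <= f j * (S%:R ^+ 2 * nu) ^+ d.-1.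
  have := prod_geD1 j fP; rewrite card_ord; apply: le_trans.
  rewrite nuE -[\prod_i f i]/(norm (a * x ^+ 2)) expr2 !normM.
  apply: ler_peMr; first by rewrite prodr_ge0 // => k _; exact: ltW.
  by rewrite -expr2 -real_normK ?num_real // exprn_ege1 // norm_ge1.
have nu_le : nu <= f j * S%:R ^+ (2 * d.-1).
  have dE := prednK (deg_gt0 E).
  rewrite -(ler_pM2r (exprn_gt0 d.-1 nu0)) -exprS dE.
  by apply: le_trans low _; rewrite exprMn -exprM mulrA.
have fij : f i <= S%:R ^+ d.*2 * f j.
  have /andP [_ fi] := fP i; apply: le_trans fi _.
  have -> : d.*2 = (2 + 2 * d.-1)%N by have := deg_gt0 E; lia.
  rewrite exprD -mulrA ler_wpM2l ?sqr_ge0 //.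
  by rewrite mulrC.
have y0 := s0 y ys.
have ylt : (index y s < size s)%N by rewrite index_mem.
have := RP ((Ordinal ylt, j), i); rewrite /= nth_index //.
rewrite -[sig j (val y)]/(emb j y) -[sig i (val y)]/(emb i y).
have fE k : f k = emb k (a * u ^+ 2) * emb k y ^+ 2.
  by rewrite /f xE exprMn mulrA [LHS]rmorphM rmorphXn.
move: fij; rewrite !fE.
have B0 : 0 < emb j (a * u ^+ 2).
  rewrite rmorphM rmorphXn mulr_gt0 ?aP // lt_def expf_neq0 ?emb_eq0 //.
  by rewrite sqr_ge0.
have p0 : 0 < emb i y ^+ 2 by rewrite lt_def expf_neq0 ?emb_eq0 // sqr_ge0.
rewrite -ler_pdivlMr // => h1 h2; apply: le_trans h1 _.
apply: le_trans (_ : _ <= S%:R ^+ d.*2 * (emb j y / emb i y) ^+ 2 * emb j (a * u ^+ 2)) _.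
  by rewrite expr_div_n le_eqVlt; apply/orP; left; apply/eqP; ring.
by rewrite ler_wpM2r // ltW.
Qed.
End BalancedUnits.

(** * Almost universal diagonal forms *)

Section DiagonalSums.
Variable K : fieldExtType rat.
Implicit Types (x y a : 'O_K) (s t : seq 'O_K).

(** A diagonal form is encoded by its list of coefficients, so that orthogonal sums become
    concatenation; [diag_repP] gives the link with [diag_form]. *)
Fixpoint diag_rep s x : Prop :=
  if s is a :: s' then exists y, diag_rep s' (x - a * y ^+ 2) else x = 0.

Lemma diag_rep0 s : diag_rep s 0.
Proof. by elim: s => //= a s IH; exists 0; rewrite expr0n mulr0 subr0. Qed.

Lemma diag_rep1 a y : diag_rep [:: a] (a * y ^+ 2).
Proof. by exists y; rewrite /= subrr. Qed.

Lemma diag_rep_cat s t x y :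
  diag_rep s x -> diag_rep t y -> diag_rep (s ++ t) (x + y).
Proof.
elim: s x => [|a s IH] x /=; first by move=> ->; rewrite add0r.
by move=> [z sz] ty; exists z; rewrite addrAC; exact: IH.
Qed.

Lemma diag_repZ s x v : diag_rep s x -> diag_rep s (x * v ^+ 2).
Proof.
elim: s x => [|a s IH] x /=; first by move=> ->; rewrite mul0r.
move=> [y /IH]; rewrite mulrBl => sy; exists (y * v).
by rewrite exprMn [a * _]mulrA.
Qed.

Lemma diag_rep_natmul a (n : nat) : diag_rep (nseq 4 a) (n%:R * a).
Proof.
have [f fE] := four_squares n.
have -> : n%:R * a = \sum_(i < 4) a * (f i)%:~R ^+ 2.
  rewrite -mulr_sumr mulrC; congr (_ * _).
  have -> : n%:R = (n%:Z)%:~R :> 'O_K by [].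
  by rewrite fE rmorph_sum; apply: eq_bigr => i _; rewrite rmorphXn.
rewrite !big_ord_recl big_ord0 addr0.
have -> : nseq 4 a = [:: a] ++ ([:: a] ++ ([:: a] ++ [:: a])) by [].
by do 3?[apply: diag_rep_cat; first exact: diag_rep1]; exact: diag_rep1.
Qed.

Lemma diag_rep_sum (I : Type) (r : seq I) (F : I -> seq 'O_K) (f : I -> 'O_K) :
  (forall i, diag_rep (F i) (f i)) ->
  diag_rep (flatten [seq F i | i <- r]) (\sum_(i <- r) f i).
Proof.
move=> Ff; elim: r => [|i r IH] /=; first by rewrite big_nil.
by rewrite big_cons; exact: diag_rep_cat.
Qed.

Lemma diag_rep_mem (I : eqType) (r : seq I) (F : I -> seq 'O_K) i x :
  i \in r -> diag_rep (F i) x -> diag_rep (flatten [seq F i | i <- r]) x.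
Proof.
move=> ir Fx; elim: r ir => //= j r IH; rewrite inE.
case/orP => [/eqP <-|/IH rx].
  by rewrite -[x]addr0; apply: diag_rep_cat => //; exact: diag_rep0.
by rewrite -[x]add0r; apply: diag_rep_cat => //; exact: diag_rep0.
Qed.

Lemma diag_repP s x :
  diag_rep s x <-> exists c : 'rV_(size s), x = diag_form (fun i => s`_i) c.
Proof.
elim: s x => [|a s IH] x /=.
  split=> [->|[c ->]]; last by rewrite /diag_form big_ord0.
  by exists 0; rewrite /diag_form big_ord0.
split=> [[y /IH [c cE]]|[c cE]].
  exists (\row_i (if unlift ord0 i is Some j then c 0 j else y)).
  rewrite /diag_form big_ord_recl mxE unlift_none /=.
  apply/eqP; rewrite addrC -subr_eq cE; apply/eqP/eq_bigr => i _.
  by rewrite mxE liftK.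
exists (c 0 ord0); apply/IH; exists (\row_i c 0 (lift ord0 i)).
rewrite cE /diag_form big_ord_recl /= addrC addKr.
by apply: eq_bigr => i _; rewrite mxE.
Qed.

Variable E : embedding_data K.
Local Notation emb := (@emb K E).

(** After balancing by a unit, an element of small size falls into the finite list [G]. A larger one
    is divided by a natural number [n] proportional to its size, coordinate by coordinate in the
    span of [w]: the quotient [be] has bounded conjugates, and the remainders are natural
    coefficients of the [w k]. *)
Lemma almost_universal_diag (B : nat) : exists s G : seq 'O_K,
  (forall a, a \in s -> forall i, B.+1%:R <= emb i a) /\
  forall a, pos_integers a ->
    diag_rep s a \/ exists2 u : 'O_K, u \is a GRing.unit & a * u ^+ 2 \in G.
Proof.
have [R RP] := balanced_unit E.
have [I [w [wB wspan]]] := integral_span E B.+1.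
have [S SP] := nat_bound (fun i : 'I_(deg E) => \sum_k emb i (w k)).
(* Each conjugate of [al] is at least [n * D], and the remainder takes at most [n * S] of it, which
   leaves [be] with conjugates at least [B + 1]. *)
pose D := (B.+1 + S)%N.
(* If [n = 0] then [T < R * D], and every conjugate is at most [R * T]. *)
have [G GP] := finite_bounded E (R * R * D)%:R.
(* If [n > 0] then [T < (n + 1) * R * D <= 2 * n * R * D], which bounds the conjugates of [be] after
   division by [n]. *)
have [F FP] := finite_bounded E (2 * R * R * D)%:R.
pose F' := [seq b <- F | [forall i, B.+1%:R <= emb i b]].
exists (flatten [seq nseq 4 b | b <- F'] ++ flatten [seq nseq 4 (w k) | k <- enum I]), G.
split=> [a|a aP].
  rewrite mem_cat => /orP [] /flattenP [l /mapP [b bF ->]] /nseqP [-> _] i.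
    by move: bF; rewrite mem_filter => /andP [/forallP].
  exact: wB.
have [u uU uR] := RP a aP; set al := a * u ^+ 2 in uR.
have alP i : 0 < emb i al.
  move/(pos_integersP E): aP => aP; have u0 : u != 0.
    by apply: contraTneq uU => ->; rewrite unitr0.
  rewrite rmorphM rmorphXn mulr_gt0 ?aP // lt_def expf_neq0 ?emb_eq0 //.
  by rewrite sqr_ge0.
pose i0 := Ordinal (deg_gt0 E); set T := emb i0 al.
have R0 : 0 < R%:R :> algR.
  rewrite ltr0n lt0n; apply/eqP => R0; have := uR i0 i0.
  by rewrite R0 mul0r leNgt alP.
have D0 : 0 < D%:R :> algR by rewrite ltr0n.
pose n := Num.trunc (T / (R%:R * D%:R)).
have RD0 : 0 < R%:R * D%:R :> algR by exact: mulr_gt0.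
have : 0 <= T / (R%:R * D%:R) by rewrite divr_ge0 // ltW // alP.
move/truncn_itv; rewrite -/n ler_pdivlMr // ltr_pdivrMr // => /andP [nle nlt].
have [n0|n0] := posnP n.
  right; exists u => //; apply: GP => i; rewrite gtr0_norm //.
  apply: le_trans (uR i i0) _; rewrite -mulnA natrM ler_wpM2l ?(ltW R0) //.
  by move: nlt; rewrite n0 mul1r natrM => /ltW.
left; suff H : diag_rep (flatten [seq nseq 4 b | b <- F'] ++
    flatten [seq nseq 4 (w k) | k <- enum I]) al.
  have -> : a = al * (u^-1) ^+ 2 by rewrite /al -mulrA -exprMn divrr // expr1n mulr1.
  exact: diag_repZ.
have [c cE] := wspan al.
have nZ : (n%:Z != 0) by lia.
pose r k := `|(c k %% n%:Z)%Z|%N; pose q k := (c k %/ n%:Z)%Z.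
have rE k : c k = q k * n%:Z + (r k)%:Z.
  by rewrite /r /q [LHS](divz_eq _ n%:Z); have := modz_ge0 (c k) nZ; lia.
have rn k : (r k <= n)%N.
  by rewrite /r; have := modz_ge0 (c k) nZ; have := ltz_mod (c k) nZ; lia.
pose be := \sum_k (q k)%:~R * w k.
have alE : al = n%:R * be + \sum_k (r k)%:R * w k.
  rewrite cE mulr_sumr -big_split; apply: eq_bigr => k _ /=.
  by rewrite {1}rE rmorphD rmorphM /= mulrDl [_ * n%:~R]mulrC -mulrA.
rewrite alE; apply: diag_rep_cat; last first.
  by rewrite -big_enum; apply: diag_rep_sum => k; exact: diag_rep_natmul.
apply: (diag_rep_mem _ (diag_rep_natmul be n)).
have nR : 0 < n%:R :> algR by rewrite ltr0n.
have remB i : 0 <= emb i (\sum_k (r k)%:R * w k) <= n%:R * S%:R.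
  have w0 k : 0 <= emb i (w k) by apply: le_trans (wB k i); rewrite ler0n.
  rewrite rmorph_sum; apply/andP; split.
    by apply: sumr_ge0 => k _; rewrite rmorphM rmorph_nat mulr_ge0.
  apply: (@le_trans _ _ (n%:R * \sum_k emb i (w k))).
    rewrite mulr_sumr; apply: ler_sum => k _.
    by rewrite rmorphM rmorph_nat ler_wpM2r // ler_nat.
  by rewrite ler_pM2l //; exact: SP.
have nbe i : n%:R * emb i be = emb i al - emb i (\sum_k (r k)%:R * w k).
  by rewrite alE rmorphD addrK rmorphM rmorph_nat.
have lo i : B.+1%:R <= emb i be.
  rewrite -(ler_pM2l nR) nbe; have /andP [_ hi] := remB i.
  have : T <= R%:R * emb i al by exact: uR.
  move=> h; have : n%:R * D%:R <= emb i al.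
    by rewrite -(ler_pM2l R0) mulrCA (le_trans nle).
  by rewrite natrD mulrDr => h'; lra.
rewrite mem_filter; apply/andP; split; first exact/forallP.
apply: FP => i; rewrite ger0_norm; last by apply: le_trans (lo i); rewrite ler0n.
rewrite -(ler_pM2l nR) nbe; have /andP [h1 _] := remB i.
apply: (@le_trans _ _ (emb i al)); first by lra.
apply: le_trans (uR i i0) _; rewrite -/T.
have : T <= 2%:R * n%:R * (R%:R * D%:R).
  apply: le_trans (ltW nlt) _; rewrite ler_pM2r // -natrM ler_nat.
  by lia.
rewrite -(ler_pM2l R0) => h; apply: le_trans h _.
by rewrite !natrM le_eqVlt; apply/orP; left; apply/eqP; ring.
Qed.

End DiagonalSums.

(** * Truants *)

Local Open Scope classical_set_scope.

Arguments emb : simpl never.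

Section SquareClasses.
Variable K : fieldExtType rat.
Implicit Types (a b : 'O_K) (L : lattice K).

Lemma sq_class_refl a : sq_class a a.
Proof. by exists 1; rewrite ?unitr1 // expr1n mulr1. Qed.

Lemma sq_class_sym a b : sq_class a b -> sq_class b a.
Proof.
case=> u uU ->; exists u^-1; first by rewrite unitrV.
by rewrite -mulrA -exprMn divrr // expr1n mulr1.
Qed.

Lemma sq_class_trans a b c : sq_class a b -> sq_class b c -> sq_class a c.
Proof.
case=> u uU -> [v vU ->]; exists (u * v); first by rewrite unitrM uU.
by rewrite exprMn [RHS]mulrA.
Qed.

Lemma sq_class_eq a b : sq_class a = sq_class b <-> sq_class a b.
Proof.
split=> [->|ab]; first exact: sq_class_refl.
by apply/seteqP; split=> x; apply: sq_class_trans => //; exact: sq_class_sym.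
Qed.

Lemma represents0 L : represents L 0.
Proof. by exists 0; rewrite -(scale0r 0) lat_formZ expr0n mul0r. Qed.

Lemma represents_sq L a u : represents L a -> represents L (a * u ^+ 2).
Proof. by case=> v ->; exists (u *: v); rewrite lat_formZ mulrC. Qed.

Lemma represents_class L a b : sq_class a b -> represents L a -> represents L b.
Proof. by case=> u _ ->; exact: represents_sq. Qed.

Definition truant (P : lattice K -> Prop) a := pos_integers a /\
  exists L, [/\ P L, ~ represents L a &
    forall b, pos_integers b -> ~ sq_class a b -> represents L b].

Definition truant_classes (P : lattice K -> Prop) : set (set 'O_K) :=
  [set sq_class a | a in truant P].

Lemma truant_class P a b : truant P a -> sq_class a b -> pos_integers b ->
  truant P b.
Proof.
move=> [_ [L [PL La Lo]]] ab bP; split=> //; exists L; split=> // [Lb|c cP nbc].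
  by apply/La/represents_class/Lb/sq_class_sym.
by apply: Lo => // ac; apply/nbc/sq_class_trans/ac/sq_class_sym.
Qed.

Lemma truant_classesP P a : pos_integers a ->
  truant_classes P (sq_class a) <-> truant P a.
Proof.
move=> aP; split=> [[b bT /sq_class_eq ba]|aT]; last by exists a.
exact: truant_class bT ba aP.
Qed.

(** Only represented values are compared, since a diagonal lattice is literally a [diag_lattice] and
    an orthogonal sum on a product module is not one. *)
Definition diag_extensible (P : lattice K -> Prop) := forall L, P L ->
  forall s : seq 'O_K, (forall a, a \in s -> pos_integers a) ->
  exists2 L', P L' & forall x, represents L' x <->
    exists v y, [/\ represents L v, diag_rep s y & x = v + y].

(** If the class of a truant were outside [C], the lattice witnessing it would be [C]-universal but
    not universal. *)
Lemma pos_criterion_truant P C : criterion_set P C -> truant_classes P `<=` C.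
Proof.
move=> [_ CP] _ [a [aP [L [PL La Lo]]] <-]; apply: contrapT => nC; apply: La.
suff : universal L by apply=> //; exists a.
apply/(CP L PL) => b bP Cb; apply: Lo => // /sq_class_eq ab.
by apply: nC; rewrite ab.
Qed.

Variable E : embedding_data K.
Local Notation emb := (@emb K E).
Local Notation norm := (@norm K E).

Lemma emb_mulsq i a b : emb i (a * b ^+ 2) = emb i a * emb i b ^+ 2.
Proof. by rewrite rmorphM rmorphXn. Qed.

Lemma embD i a b : emb i (a + b) = emb i a + emb i b.
Proof. exact: rmorphD. Qed.

Lemma pos_emb a i : pos_integers a -> 0 < emb i a.
Proof. by move/(pos_integersP E). Qed.

Lemma lat_form_ge0 L (v : L) i : 0 <= emb i (lat_form v).
Proof.
have [->|v0] := eqVneq v 0.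
  by rewrite -(scale0r 0) lat_formZ expr0n mul0r rmorph0.
exact/ltW/pos_emb/lat_pos.
Qed.

Lemma diag_rep_ge0 s y i : (forall a, a \in s -> pos_integers a) ->
  diag_rep s y -> 0 <= emb i y.
Proof.
elim: s y => [|a s IH] y sP; first by move=> ->; rewrite rmorph0.
case=> c /IH H; have {}H : 0 <= emb i (y - a * c ^+ 2).
  by apply: H => b bs; apply: sP; rewrite inE bs orbT.
rewrite -[y](subrK (a * c ^+ 2)) embD addr_ge0 // emb_mulsq.
apply: mulr_ge0; last exact: sqr_ge0.
apply/ltW/pos_emb.
by apply: sP; rewrite mem_head.
Qed.

(** A nonzero value has some nonzero term, and every other term is nonnegative in each embedding. *)
Lemma diag_rep_term s y : (forall a, a \in s -> pos_integers a) ->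
  diag_rep s y -> y != 0 -> exists a c, [/\ a \in s, c != 0 &
    forall i, emb i (a * c ^+ 2) <= emb i y].
Proof.
elim: s y => [|a s IH] y sP; first by move=> ->; rewrite eqxx.
have sP' b : b \in s -> pos_integers b by move=> bs; apply: sP; rewrite inE bs orbT.
case=> c ys y0; have [c0|c0] := eqVneq c 0.
  move: ys; rewrite c0 expr0n mulr0 subr0 => ys.
  have [b [e [bs e0 H]]] := IH y sP' ys y0.
  by exists b, e; split=> //; rewrite inE bs orbT.
exists a, c; split; rewrite ?mem_head // => i.
by rewrite -subr_ge0 -rmorphB; exact: diag_rep_ge0 ys.
Qed.

Lemma norm_le a b : pos_integers a -> (forall i, emb i a <= emb i b) ->
  norm a <= norm b ?= iff (a == b).
Proof.
move=> /(pos_integersP E) aP ab; split.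
  by apply: ler_prod => i _; rewrite ab ltW.
apply/eqP/eqP => [|->//] ne; apply/eqP; apply: contraTT isT => nab.
have i0 := Ordinal (deg_gt0 E).
have lt : emb i0 a < emb i0 b.
  by rewrite lt_def ab andbT eq_sym; apply: contra_neq nab => /emb_inj.
have : norm a < norm b; last by rewrite ne ltxx.
rewrite /norm (bigD1 i0) // [ltRHS](bigD1 i0) //=.
have pa : 0 < \prod_(i | i != i0) emb i a by apply: prodr_gt0.
apply: (@lt_le_trans _ _ (emb i0 b * \prod_(i | i != i0) emb i a)).
  by rewrite ltr_pM2r.
rewrite ler_pM2l; last exact: lt_trans lt.
by apply: ler_prod => i _; rewrite ab ltW.
Qed.

Lemma pos_norm a : pos_integers a -> exists2 n : nat, (0 < n)%N & norm a = n%:R.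
Proof.
move=> aP; have aE : forall i, 0 < emb i a by apply/(pos_integersP E).
have a0 : a != 0.
  by rewrite -(emb_eq0 (Ordinal (deg_gt0 E))) lt0r_neq0.
have [n [_ [nE _]]] := norm_cofactor E a0.
have : 0 < norm a by apply: prodr_gt0.
rewrite nE ltr0z; case: n {nE} (nE) => // n nE n0.
by exists n.
Qed.

Lemma norm_sqM_ge a c : pos_integers a -> c != 0 -> norm a <= norm (a * c ^+ 2).
Proof.
move=> aP c0; rewrite expr2 !normM -expr2.
apply: ler_peMr; last by rewrite -real_normK ?num_real // exprn_ege1 // norm_ge1.
by apply: prodr_ge0 => i _; rewrite ltW // pos_emb.
Qed.

Lemma missed_truant P L : diag_extensible P -> P L -> ~ universal L ->
  exists2 a, truant P a & ~ represents L a.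
Proof.
move=> ext PL nuL.
pose missed n := `[< exists a, [/\ pos_integers a, ~ represents L a & norm a = n%:R] >].
have : exists n, missed n.
  apply: contrapT => none; apply: nuL => a aP _; apply: contrapT => La.
  have [n _ nE] := pos_norm aP; apply: none; exists n.
  by apply/asboolP; exists a.
case/ex_minnP => n /asboolP [a [aP La aN]] nmin.
have [s [G [sB sG]]] := almost_universal_diag E n.
(* The exceptional elements still to be added: those missed by [L] and outside the class of [a]. *)
pose G' := [seq g <- G | `[< [/\ pos_integers g, ~ represents L g & ~ sq_class a g] >]].
have sP b : b \in s ++ G' -> pos_integers b.
  rewrite mem_cat => /orP [bs|]; last by rewrite mem_filter => /andP [/asboolP []].
  by apply/(pos_integersP E) => i; apply: lt_le_trans (sB b bs i); rewrite ltr0n.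
have [L' PL' L'P] := ext L PL (s ++ G') sP.
exists a => //; split=> //; exists L'; split=> //.
  case/L'P => v [y [[w vE] yP aE]].
  have y0 : y != 0.
    apply: contra_notN La => /eqP y0; exists w.
    by rewrite aE y0 addr0.
  have [b [c [bs c0 bc]]] := diag_rep_term sP yP y0.
  have bP := sP b bs.
  have bca i : emb i (b * c ^+ 2) <= emb i a.
    by rewrite aE embD vE (le_trans (bc i)) // lerDr lat_form_ge0.
  have bcP : pos_integers (b * c ^+ 2).
    apply/(pos_integersP E) => i; rewrite emb_mulsq mulr_gt0 ?pos_emb //.
    by rewrite lt_def expf_neq0 ?emb_eq0 // sqr_ge0.
  have [Nle Neq] := norm_le bcP bca.
  have Nb := norm_sqM_ge bP c0.
  (* A coefficient from [s] has all conjugates at least [n + 1], hence norm larger than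
     [norm a = n], too large for a summand of [a]. *)
  move: bs; rewrite mem_cat => /orP [bs|].
    have : n.+1%:R <= norm b.
      have i0 := Ordinal (deg_gt0 E).
      apply: (@le_trans _ _ (n.+1%:R ^+ deg E)).
        by rewrite -natrX ler_nat -[leqLHS]expn1 leq_pexp2l // deg_gt0.
      rewrite -[X in _ ^+ X]card_ord -prodr_const; apply: ler_prod => i _.
      by rewrite ler0n sB.
    move=> h; have := le_trans h (le_trans Nb Nle).
    by rewrite aN ler_nat ltnn.
  (* A coefficient [b] from [G'] is missed by [L], so minimality gives [norm a <= norm b]. All
     inequalities become equalities: [b * c ^+ 2 = a] with [c] a unit, against the choice of
     [G']. *)
  rewrite mem_filter => /andP [/asboolP [_ Lb nab] _].
  have [m _ mE] := pos_norm bP.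
  have nm : (n <= m)%N by apply: nmin; apply/asboolP; exists b.
  have Nba : norm a <= norm b by rewrite aN mE ler_nat.
  have NE : norm (b * c ^+ 2) = norm a.
    by apply/eqP; rewrite eq_le Nle (le_trans Nba).
  have /eqP bE : b * c ^+ 2 == a by rewrite -Neq NE.
  apply: nab; apply: sq_class_sym; exists c; last by rewrite bE.
  apply: (norm_unit (E := E)).
  have : norm b = norm a.
    by apply/eqP; rewrite eq_le Nba andbT -NE.
  move=> Nbe; have a0 : norm a != 0.
    by have [k k0 ->] := pos_norm aP; rewrite pnatr_eq0 -lt0n.
  apply: (mulfI a0).
  by rewrite mulr1 -[in LHS]Nbe expr2 -!normM -expr2 bE.
(* An element outside the class of [a] is a value of the form [s], or of [L], or up to a unit square
   it is itself a coefficient in [G']. *)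
move=> b bP nab; apply/L'P; have [bs|[u uU uG]] := sG b bP.
  exists 0, b; split; rewrite ?add0r //; first exact: represents0.
  by rewrite -[b]addr0; apply: diag_rep_cat => //; exact: diag_rep0.
have [Lb|Lb] := pselect (represents L b).
  by exists b, 0; rewrite addr0; split=> //; exact: diag_rep0.
have uuE : b = b * u ^+ 2 * u^-1 ^+ 2.
  by rewrite -mulrA -exprMn divrr // expr1n mulr1.
have ubP : pos_integers (b * u ^+ 2).
  apply/(pos_integersP E) => i; rewrite emb_mulsq mulr_gt0 ?pos_emb //.
  rewrite lt_def expf_neq0 ?emb_eq0 ?sqr_ge0 //.
  by apply: contraTneq uU => ->; rewrite unitr0.
have uG' : b * u ^+ 2 \in G'.
  rewrite mem_filter uG andbT; apply/asboolP; split=> //.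
    by move=> Lu; apply: Lb; rewrite uuE; exact: represents_sq.
  by move=> au; apply: nab; apply: sq_class_trans au (sq_class_sym _); exists u.
exists 0, b; split; rewrite ?add0r //; first exact: represents0.
rewrite uuE; apply: diag_repZ; rewrite -[_ * _]add0r.
apply: diag_rep_cat; first exact: diag_rep0.
(* [G'] is seen as a concatenation of one-element lists, the shape that [diag_rep_mem] expects. *)
rewrite -[G']map_id -[[seq _ | _ <- _]]flatten_seq1.
rewrite -map_comp; apply: (diag_rep_mem uG').
by have := diag_rep1 (b * u ^+ 2) 1; rewrite expr1n mulr1.
Qed.

(** The truant classes lie in every criterion set and, by [missed_truant], form one themselves; they
    are thus the least criterion set. *)
Lemma truant_unique P : diag_extensible P ->
  unique (minimal_criterion_set P) (truant_classes P).
Proof.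
move=> ext.
have crit : criterion_set P (truant_classes P).
  split=> [_ [a [aP _] <-]|L PL]; first by exists a.
  split=> [uL a aP _|tL]; first by apply: uL => //; exists a.
  apply: contrapT => nuL; have [a aT La] := missed_truant ext PL nuL.
  by apply: La; apply: tL; [case: aT | exists a].
split=> [|C [Ccrit Cmin]].
  split=> // C' C'crit C'T; apply/seteqP; split=> //.
  exact: pos_criterion_truant.
by apply: Cmin => //; exact: pos_criterion_truant.
Qed.

End SquareClasses.

(** * Orthogonal sums *)

Section OrthogonalSum.
Variables (K : fieldExtType rat) (L1 L2 : lattice K).

Definition ortho_form (v : (L1 * L2)%type) : 'O_K :=
  lat_form v.1 + lat_form v.2.

Lemma ortho_polarE v w : polar ortho_form v w =
  polar (@lat_form _ L1) v.1 w.1 + polar (@lat_form _ L2) v.2 w.2.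
Proof.
rewrite /polar /ortho_form -mulrDl; congr (_ / _).
by rewrite !raddfD /=; ring.
Qed.

Lemma ortho_polarl (a : 'O_K) (u v w : (L1 * L2)%type) :
  polar ortho_form (a *: u + v) w
    = val a * polar ortho_form u w + polar ortho_form v w.
Proof. by rewrite !ortho_polarE !lat_polarl; ring. Qed.

Lemma ortho_polarr (a : 'O_K) (u v w : (L1 * L2)%type) :
  polar ortho_form w (a *: u + v)
    = val a * polar ortho_form w u + polar ortho_form w v.
Proof. by rewrite !ortho_polarE !lat_polarr; ring. Qed.

Lemma ortho_formZ (a : 'O_K) (v : (L1 * L2)%type) :
  ortho_form (a *: v) = a ^+ 2 * ortho_form v.
Proof. by rewrite /ortho_form !lat_formZ mulrDr. Qed.

Lemma ortho_tf : torsion_free (L1 * L2)%type.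
Proof.
move=> a [v w] /(congr1 (fun p => (p.1, p.2))) [/lat_tf av /lat_tf aw].
case: av => [|->]; first by left.
by case: aw => [|->]; [left | right].
Qed.

Definition ortho_gen n m (e : 'I_n -> L1) (f : 'I_m -> L2) (k : 'I_(n + m)) :
    (L1 * L2)%type :=
  match split k with inl i => (e i, 0) | inr j => (0, f j) end.

Lemma ortho_genE n m (e : 'I_n -> L1) (f : 'I_m -> L2) (c : 'rV['O_K]_(n + m)) :
  \sum_k c 0 k *: ortho_gen e f k
    = (\sum_i lsubmx c 0 i *: e i, \sum_j rsubmx c 0 j *: f j).
Proof.
rewrite big_split_ord /=.
have El i : split (lshift m i) = inl i by exact: (unsplitK (inl i)).
have Er j : split (rshift n j) = inr j by exact: (unsplitK (inr j)).
under eq_bigr do rewrite /ortho_gen El.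
under [X in _ + X]eq_bigr do rewrite /ortho_gen Er.
have Sl : \sum_i c 0 (lshift m i) *: ((e i, 0) : (L1 * L2)%type) =
    (\sum_i lsubmx c 0 i *: e i, 0).
  elim/big_rec2: _ => // i y1 y2 _ ->.
  by congr pair; rewrite /= ?mxE ?scaler0 ?addr0.
have Sr : \sum_j c 0 (rshift n j) *: ((0, f j) : (L1 * L2)%type) =
    (0, \sum_j rsubmx c 0 j *: f j).
  elim/big_rec2: _ => // i y1 y2 _ ->.
  by congr pair; rewrite /= ?mxE ?scaler0 ?addr0.
by rewrite Sl Sr; congr pair; rewrite /= ?addr0 ?add0r.
Qed.

Lemma ortho_fg : finitely_generated (L1 * L2)%type.
Proof.
have [n [e eP]] := @lat_fg _ L1; have [m [f fP]] := @lat_fg _ L2.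
exists (n + m)%N, (ortho_gen e f) => -[v w].
have [c ->] := eP v; have [b ->] := fP w.
by exists (row_mx c b); rewrite ortho_genE row_mxKl row_mxKr.
Qed.

Lemma ortho_free : free_module L1 -> free_module L2 ->
  free_module (L1 * L2)%type.
Proof.
move=> [n [e eP]] [m [f fP]]; exists (n + m)%N, (ortho_gen e f) => -[v w].
have [c [cE cU]] := eP v; have [b [bE bU]] := fP w.
exists (row_mx c b); split; first by rewrite ortho_genE row_mxKl row_mxKr -cE -bE.
move=> x; rewrite ortho_genE => -[/cU -> /bU ->].
by rewrite hsubmxK.
Qed.

Lemma ortho_pos (v : (L1 * L2)%type) : v != 0 -> pos_integers (ortho_form v).
Proof.
case: v => v w vw0 s sR; rewrite /ortho_form rmorphD /=.
have ge0 (L : lattice K) (x : L) : 0 <= s (val (lat_form x)).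
  have [->|x0] := eqVneq x 0; last exact/ltW/lat_pos.
  by rewrite -(scale0r 0) lat_formZ expr0n mul0r !rmorph0.
have [v0|v0] := eqVneq v 0; last first.
  by apply: ltr_pwDl; [exact: lat_pos | exact: ge0].
apply: ltr_wpDl; first exact: ge0.
by apply: lat_pos => //; apply: contra_neq vw0 => ->; rewrite v0.
Qed.

Definition ortho_lattice : lattice K :=
  Lattice ortho_fg ortho_tf ortho_formZ ortho_polarl ortho_polarr ortho_pos.

End OrthogonalSum.

(** * Adding diagonal summands within each class of lattices *)

Section Extensible.
Variable K : fieldExtType rat.

Lemma seq_pos (s : seq 'O_K) : (forall a, a \in s -> pos_integers a) ->
  forall i : 'I_(size s), pos_integers s`_i.
Proof. by move=> sP i; apply/sP/mem_nth. Qed.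

Lemma diag_form_integral (n : nat) (a : 'I_n -> 'O_K) (v w : 'rV['O_K]_n) :
  polar (diag_form a) v w \in @integral_pred K.
Proof.
rewrite diag_polarE rpred_sum // => i _.
by rewrite !rpredM //; exact: int_valP.
Qed.

Lemma rV_free n : @free_module K 'rV['O_K]_n.
Proof.
exists n, (fun i => delta_mx 0 i) => v; exists v.
split=> [|c ->]; first exact: row_sum_delta.
by rewrite -row_sum_delta.
Qed.

Lemma ortho_diag_represents (L : lattice K) (s : seq 'O_K)
    (sP : forall i : 'I_(size s), pos_integers s`_i) x :
  represents (ortho_lattice L (diag_lattice sP)) x <->
    exists v y, [/\ represents L v, diag_rep s y & x = v + y].
Proof.
split=> [[[v w] ->]|[_ [y [[v ->] /diag_repP [c ->] ->]]]].
  exists (lat_form v), (diag_form (fun i : 'I_(size s) => s`_i) w).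
  by split=> //; [exists v | apply/diag_repP; exists w].
by exists (v, c).
Qed.

Lemma classical_ortho (L1 L2 : lattice K) :
  classical_lattice L1 -> classical_lattice L2 ->
  classical_lattice (ortho_lattice L1 L2).
Proof.
by move=> c1 c2 v w; rewrite ortho_polarE rpredD //; [exact: c1 | exact: c2].
Qed.

Lemma diag_classical_free (L : lattice K) :
  diagonal_lattice L -> classical_free_lattice L.
Proof.
move=> [n [a [aP ->]]]; split; last exact: rV_free.
by move=> v w; exact: diag_form_integral.
Qed.

Lemma ortho_extensible (P : lattice K -> Prop) :
  (forall L1 L2, P L1 -> diagonal_lattice L2 -> P (ortho_lattice L1 L2)) ->
  diag_extensible P.
Proof.
move=> Portho L PL s sP; exists (ortho_lattice L (diag_lattice (seq_pos sP))).
  by apply: Portho => //; exists (size s), (fun i => s`_i), (seq_pos sP).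
exact: ortho_diag_represents.
Qed.

Lemma extensible_any : diag_extensible (@any_lattice K).
Proof. exact: ortho_extensible. Qed.

Lemma extensible_free : diag_extensible (@free_lattice K).
Proof.
by apply: ortho_extensible => L1 L2 f1 /diag_classical_free [_]; exact: ortho_free.
Qed.

Lemma extensible_classical : diag_extensible (@classical_lattice K).
Proof.
by apply: ortho_extensible => L1 L2 f1 /diag_classical_free [? _];
  exact: classical_ortho.
Qed.

Lemma extensible_classical_free : diag_extensible (@classical_free_lattice K).
Proof.
apply: ortho_extensible => L1 L2 [c1 f1] /diag_classical_free [c2 f2].
by split; [exact: classical_ortho | exact: ortho_free].
Qed.

(** The orthogonal sum is rebuilt on row vectors with the concatenated coefficients, so that the
    result is again a [diag_lattice]. *)
Lemma extensible_diagonal : diag_extensible (@diagonal_lattice K).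
Proof.
move=> _ [n [a [aP ->]]] s sP.
pose b (k : 'I_(n + size s)) : 'O_K :=
  match split k with inl i => a i | inr j => s`_j end.
have bP k : pos_integers (b k).
  by rewrite /b; case: (split k) => [i|j]; [exact: aP | exact: seq_pos].
have bE c : diag_form b c = diag_form a (lsubmx c) +
    diag_form (fun i : 'I_(size s) => s`_i) (rsubmx c).
  rewrite /diag_form big_split_ord; congr (_ + _); apply: eq_bigr => k _.
    by rewrite /b (unsplitK (inl k)) mxE.
  by rewrite /b (unsplitK (inr k)) mxE.
exists (diag_lattice bP); first by exists (n + size s)%N, b, bP.
move=> x; split=> [[c ->]|[_ [y [[v ->] /diag_repP [c ->] ->]]]].
  rewrite /= bE; exists (diag_form a (lsubmx c)), (diag_form (fun i : 'I_(size s) => s`_i) (rsubmx c)).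
  split=> //; first by exists (lsubmx c).
  by apply/diag_repP; exists (rsubmx c).
by exists (row_mx v c); rewrite /= bE row_mxKl row_mxKr.
Qed.

End Extensible.

(** * Transport of lattices *)

Section Scaling.
Variables (K : fieldExtType rat) (L : lattice K) (e : 'O_K).
Hypothesis eP : pos_integers e.

Definition scale_form (v : L) : 'O_K := e * lat_form v.

Lemma scale_polarE v w :
  polar scale_form v w = val e * polar (@lat_form _ L) v w.
Proof. by rewrite /polar /scale_form !rmorphM /=; ring. Qed.

Lemma scale_formZ (a : 'O_K) (v : L) :
  scale_form (a *: v) = a ^+ 2 * scale_form v.
Proof. by rewrite /scale_form lat_formZ mulrCA. Qed.

Lemma scale_polarl (a : 'O_K) (u v w : L) :
  polar scale_form (a *: u + v) w
    = val a * polar scale_form u w + polar scale_form v w.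
Proof. by rewrite !scale_polarE lat_polarl; ring. Qed.

Lemma scale_polarr (a : 'O_K) (u v w : L) :
  polar scale_form w (a *: u + v)
    = val a * polar scale_form w u + polar scale_form w v.
Proof. by rewrite !scale_polarE lat_polarr; ring. Qed.

Lemma pos_integersM (a b : 'O_K) :
  pos_integers a -> pos_integers b -> pos_integers (a * b).
Proof. by move=> aP bP s sR; rewrite !rmorphM mulr_gt0 ?aP ?bP. Qed.

Lemma scale_pos (v : L) : v != 0 -> pos_integers (scale_form v).
Proof. by move=> /lat_pos vP; exact: pos_integersM. Qed.

Definition scale_lattice : lattice K :=
  Lattice (@lat_fg _ L) (@lat_tf _ L) scale_formZ scale_polarl scale_polarr
    scale_pos.

Lemma scale_represents x : represents L x -> represents scale_lattice (e * x).
Proof. by case=> v ->; exists v. Qed.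

End Scaling.

Section Twist.
Variable K : fieldExtType rat.

Section IntegersMap.
Variable s : {rmorphism K -> K}.

Lemma integers_map_zmod : zmod_morphism (integers_map s).
Proof. by move=> x y; apply: val_inj; rewrite /= !rmorphB. Qed.

Lemma integers_map_monoid : monoid_morphism (integers_map s).
Proof. by split=> [|x y]; apply: val_inj; rewrite /= ?rmorph1 ?rmorphM. Qed.

HB.instance Definition _ :=
  GRing.isZmodMorphism.Build 'O_K 'O_K (integers_map s) integers_map_zmod.
HB.instance Definition _ :=
  GRing.isMonoidMorphism.Build 'O_K 'O_K (integers_map s) integers_map_monoid.

Lemma integers_map_pos (a : 'O_K) :
  pos_integers a -> pos_integers (integers_map s a).
Proof.
move=> aP t tR; pose u : {rmorphism K -> algC} := t \o s.
by apply: (aP u) => x; exact: tR.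
Qed.

End IntegersMap.

(** An alias of [V], so that the same group can carry a second module structure in which [a] acts as
    [t a]. *)
Definition twisted (t : {rmorphism 'O_K -> 'O_K}) (V : lmodType 'O_K) : Type := V.

Section TwistedModule.
Variables (t : {rmorphism 'O_K -> 'O_K}) (V : lmodType 'O_K).

HB.instance Definition _ := GRing.Zmodule.on (twisted t V).

Definition twisted_scale (a : 'O_K) (v : twisted t V) : twisted t V :=
  t a *: (v : V).

Lemma twisted_scaleA a b v :
  twisted_scale a (twisted_scale b v) = twisted_scale (a * b) v.
Proof. by rewrite /twisted_scale scalerA rmorphM. Qed.

Lemma twisted_scale1 : left_id 1 twisted_scale.
Proof. by move=> v; rewrite /twisted_scale rmorph1 scale1r. Qed.

Lemma twisted_scaleDr : right_distributive twisted_scale +%R.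
Proof. by move=> a v w; exact: scalerDr. Qed.

Lemma twisted_scaleDl v : {morph twisted_scale^~ v : a b / a + b}.
Proof. by move=> a b; rewrite /twisted_scale rmorphD; exact: scalerDl. Qed.

HB.instance Definition _ := GRing.Zmodule_isLmodule.Build 'O_K (twisted t V)
  twisted_scaleA twisted_scale1 twisted_scaleDr twisted_scaleDl.

End TwistedModule.

Variables (s r : {rmorphism K -> K}).
Hypotheses (sK : cancel s r) (rK : cancel r s).
Local Notation f := (integers_map s).
Local Notation g := (integers_map r).

Lemma integers_mapK : cancel f g.
Proof. by move=> x; apply: val_inj; exact: sK. Qed.

Lemma integers_mapVK : cancel g f.
Proof. by move=> x; apply: val_inj; exact: rK. Qed.

Section TwistedLattice.
Variable L : lattice K.
Local Notation M := (twisted g L).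

(** Scalars of [M] act through [g], the inverse of [f], so that applying [f] to the values turns the
    factor [g a ^+ 2] back into [a ^+ 2]. *)
Definition twist_form (v : M) : 'O_K := f (@lat_form _ L v).

Lemma twist_polarE (v w : M) :
  polar twist_form v w = s (polar (@lat_form _ L) v w).
Proof. by rewrite /polar /twist_form fmorph_div rmorph_nat !rmorphB. Qed.

Lemma twist_fg : finitely_generated M.
Proof.
have [n [e eP]] := @lat_fg _ L; exists n, e => v; have [c ->] := eP v.
exists (map_mx f c); apply: eq_bigr => i _.
by rewrite mxE -[in LHS](integers_mapK (c 0 i)).
Qed.

Lemma twist_free : free_module L -> free_module M.
Proof.
move=> [n [e eP]]; exists n, e => v; have [c [cE cU]] := eP v.
exists (map_mx f c); split=> [|b bE].
  rewrite {1}cE; apply: eq_bigr => i _.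
  by rewrite mxE -[in LHS](integers_mapK (c 0 i)).
have -> : c = map_mx g b.
  apply: cU; rewrite {1}bE; apply: eq_bigr => i _.
  by rewrite mxE.
by apply/rowP => i; rewrite !mxE integers_mapVK.
Qed.

Lemma twist_tf : torsion_free M.
Proof.
move=> a v /(@lat_tf _ L) [ga|->]; last by right.
by left; rewrite -[a]integers_mapVK ga rmorph0.
Qed.

Lemma twist_formZ (a : 'O_K) (v : M) :
  twist_form (a *: v) = a ^+ 2 * twist_form v.
Proof.
transitivity (f (g a ^+ 2 * @lat_form _ L v)).
  by congr (f _); exact: (@lat_formZ _ L).
by rewrite rmorphM rmorphXn /= integers_mapVK.
Qed.

Lemma twist_polarl (a : 'O_K) (u v w : M) :
  polar twist_form (a *: u + v) w
    = val a * polar twist_form u w + polar twist_form v w.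
Proof.
rewrite !twist_polarE; transitivity (s (val (g a) *
  polar (@lat_form _ L) u w + polar (@lat_form _ L) v w)).
  by congr (s _); exact: (@lat_polarl _ L).
by rewrite rmorphD rmorphM /= rK.
Qed.

Lemma twist_polarr (a : 'O_K) (u v w : M) :
  polar twist_form w (a *: u + v)
    = val a * polar twist_form w u + polar twist_form w v.
Proof.
rewrite !twist_polarE; transitivity (s (val (g a) *
  polar (@lat_form _ L) w u + polar (@lat_form _ L) w v)).
  by congr (s _); exact: (@lat_polarr _ L).
by rewrite rmorphD rmorphM /= rK.
Qed.

Lemma twist_pos (v : M) : v != 0 -> pos_integers (twist_form v).
Proof. by move=> /(@lat_pos _ L) vP; exact: integers_map_pos. Qed.

Definition twist_lattice : lattice K :=
  Lattice twist_fg twist_tf twist_formZ twist_polarl twist_polarr twist_pos.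

Lemma twist_represents x : represents L x -> represents twist_lattice (f x).
Proof. by case=> v ->; exists v. Qed.

Lemma twist_represents_inv x : represents twist_lattice (f x) -> represents L x.
Proof. by case=> v /(can_inj integers_mapK) ->; exists v. Qed.

Lemma twist_classical : classical_lattice L -> classical_lattice twist_lattice.
Proof.
move=> cL v w; rewrite twist_polarE.
exact: (integral_pred_rmorph s (Integer (cL v w))).
Qed.

End TwistedLattice.
End Twist.

(** * Invertible ideals and integral projections *)

Section Content.
Variable F : fieldType.
Implicit Types (u : {poly F}) (r : F).

(** Induction on the degree. The leading coefficient [c] of [u] is integral, and so is [c * r] by
    [integral_lead_root]; removing the leading term of [u] therefore preserves the hypothesis. *)
Lemma integral_coefs_quotient u r :
  (forall i, Zintegral (u * ('X - r%:P))`_i) -> forall i, Zintegral u`_i.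
Proof.
have [n] := ubnP (size u); elim: n u => // n IH u; rewrite ltnS => un uI.
have [->|u0] := eqVneq u 0; first by move=> i; rewrite coef0; exact: integral0.
set c := lead_coef u; set m := (size u).-1.
have hE : lead_coef (u * ('X - r%:P)) = c.
  by rewrite lead_coefM lead_coefXsubC mulr1.
have cI : Zintegral c by rewrite -hE; exact: uI.
have crI : Zintegral (c * r).
  rewrite -hE; apply: integral_lead_root => //.
  by rewrite rootM root_XsubC eqxx orbT.
have szu : size u = m.+1 by rewrite polySpred.
have XI (a : F) (k i : nat) : Zintegral a -> Zintegral (a *: 'X^k)`_i.
  by move=> aI; rewrite coefZ coefXn; apply: integral_mul => //; exact: integral_nat.
have u'I : forall i, Zintegral (u - c *: 'X^m)`_i.
  apply: IH => [|i].
    apply: leq_trans un; rewrite szu ltnS; apply/leq_sizeP => j.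
    rewrite leq_eqVlt coefB coefZ coefXn => /orP [/eqP <-|mj].
      by rewrite eqxx mulr1 subrr.
    rewrite gtn_eqF // mulr0 subr0 nth_default //.
    by rewrite szu.
  have -> : (u - c *: 'X^m) * ('X - r%:P) =
      u * ('X - r%:P) - c *: 'X^(m.+1) + (c * r) *: 'X^m.
    by rewrite -!mul_polyC polyCM exprS; ring.
  rewrite coefD coefB; apply: integral_add; last exact: XI.
  by apply: integral_sub; [exact: uI | exact: XI].
move=> i; rewrite -[u](subrK (c *: 'X^m)) coefD.
by apply: integral_add; [exact: u'I | exact: XI].
Qed.

(** Induction on the roots, moving one factor ['X - r] from the product to [u]. For each coefficient
    [q] of the remaining product, [integral_coefs_quotient] applied to [q *: u] removes that factor
    again. *)
Lemma integral_coefs_prod (rs : seq F) u :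
  (forall i, Zintegral (u * \prod_(r <- rs) ('X - r%:P))`_i) ->
  forall k i, Zintegral ((\prod_(r <- rs) ('X - r%:P))`_k * u`_i).
Proof.
elim: rs u => [|r rs IH] u uI k i.
  move: (uI i); rewrite !big_nil mulr1 coef1 => H.
  by apply: integral_mul => //; exact: integral_nat.
rewrite big_cons; set Q := \prod_(r <- rs) _ in IH *.
have H : forall k i, Zintegral (Q`_k * (u * ('X - r%:P))`_i).
  by apply: IH => j; move: (uI j); rewrite big_cons mulrA.
have Hu l j : Zintegral (Q`_l * u`_j).
  rewrite -coefZ; apply: (@integral_coefs_quotient _ r) => {}j.
  by rewrite -scalerAl coefZ.
have Hr l j : Zintegral (Q`_l * (r * u`_j)).
  have := H l j; rewrite [u * _]mulrBr coefB coefMC coefMX => Hlj.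
  move: Hlj; set t := (if _ then _ else _) => Hlj.
  have tI : Zintegral (Q`_l * t).
    by rewrite /t; case: ifP => _; rewrite ?mulr0; [exact: integral0 | exact: Hu].
  have -> : Q`_l * (r * u`_j) = Q`_l * t - Q`_l * (t - u`_j * r) by ring.
  exact: integral_sub.
rewrite mulrBl coefB coefXM coefCM mulrBl; apply: integral_sub.
  by case: ifP => _; rewrite ?mul0r; [exact: integral0 | exact: Hu].
by rewrite -mulrA mulrCA; exact: Hr.
Qed.

End Content.

(* Dedekind's Prague theorem. *)
Lemma integral_coef_mul (f g : {poly algC}) :
  (forall i, Zintegral (f * g)`_i) -> forall k i, Zintegral (f`_k * g`_i).
Proof.
have [rs fE] := closed_field_poly_normal f.
move=> fgI k i; rewrite fE coefZ -mulrA mulrCA -coefZ.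
by apply: integral_coefs_prod => j; rewrite -scalerAl mulrC scalerAl -fE.
Qed.

Lemma bezout_seq (s : seq int) : exists (c : nat -> int) (g : int),
  \sum_(i < size s) c i * s`_i = g /\ forall i, (g %| s`_i)%Z.
Proof.
elim: s => [|a s [c [g [cE gs]]]].
  by exists (fun=> 0), 0; rewrite big_ord0; split=> // i; rewrite nth_nil.
have [u [v uv]] := Bezoutz a g.
exists (fun i => if i is j.+1 then v * c j else u), (gcdz a g); split.
  rewrite big_ord_recl /= -uv -cE mulr_sumr; congr (_ + _).
  by apply: eq_bigr => i _; rewrite mulrA.
by case=> [|i] /=; [exact: dvdz_gcdl | apply: dvdz_trans (gs i); exact: dvdz_gcdr].
Qed.

Section InvertibleIdeals.
Variables (K : fieldExtType rat) (E : embedding_data K).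

Lemma poly_integral_over (f : {poly K}) :
  integralOver (map_poly (in_alg K)) f.
Proof.
rewrite -[f]coefK poly_def.
elim/big_ind: _ => [||i _]; [exact: integral0 | exact: integral_add |].
rewrite -mul_polyC; apply: integral_mul; last first.
  by rewrite -(map_polyXn (in_alg K)); exact: integral_id.
have /polyOver1P [p pE] := minPolyOver 1%AS f`_i.
have pm : p \is monic by rewrite -(map_monic (in_alg K)) -pE monic_minPoly.
exists (map_poly polyC p); first by rewrite map_monic.
rewrite -map_poly_comp.
have -> : map_poly (map_poly (in_alg K) \o polyC) p = map_poly polyC (map_poly (in_alg K) p).
  by rewrite -map_poly_comp; apply: eq_map_poly => x /=; rewrite map_polyC.
rewrite -pE rootE horner_map.
by rewrite minPolyxx.
Qed.

(** In an algebraic equation of [f] over the rational polynomials the constant term is a multiple of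
    [f]. When it vanishes, [f] is cancelled and the degree of the equation drops. *)
Lemma poly_rat_multiple (f : {poly K}) : f != 0 ->
  exists (g : {poly K}) (q : {poly rat}), q != 0 /\ f * g = map_poly (in_alg K) q.
Proof.
move=> f0; have [P Pm] := poly_integral_over f.
have := monic_neq0 Pm; have [n] := ubnP (size P).
elim: n P {Pm} => // n IH P; rewrite ltnS => Pn P0 Pf.
have /factor_theorem [Q] : root (P - (P`_0)%:P) 0.
  by rewrite rootE hornerD hornerN hornerC horner_coef0 subrr.
rewrite subr0 => /(canRL (subrK _)) PE.
have Pf' : (map_poly (map_poly (in_alg K)) Q).[f] * f
    + map_poly (in_alg K) P`_0 = 0.
  have := rootP Pf; rewrite {1}PE rmorphD rmorphM /= map_polyX map_polyC.
  by rewrite hornerD hornerM hornerX hornerC.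
have [P00|P00] := eqVneq P`_0 0; last first.
  exists (- (map_poly (map_poly (in_alg K)) Q).[f]), P`_0; split=> //.
  by rewrite mulrN mulrC; apply/eqP; rewrite eq_sym -addr_eq0 addrC Pf'.
have Q0 : Q != 0.
  by apply: contra_neq P0 => Q0; rewrite PE Q0 P00 mul0r add0r.
apply: (IH Q) => //.
  by move: Pn; rewrite PE P00 addr0 size_mulX.
move/eqP: Pf'; rewrite P00 rmorph0 addr0 mulf_eq0 (negPf f0) orbF.
by move/eqP/rootP.
Qed.

(** The entries of [a] generate a fractional ideal, and [b] exhibits its invertibility. With [f] the
    polynomial whose coefficients are the entries of [a], some multiple [f * h] is a primitive
    integer polynomial. Prague's theorem makes the products of coefficients integral, and a Bezout
    relation between the coefficients of [f * h] provides [b]. *)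
Lemma invertible_vector (n : nat) (a : 'cV[K]_n) : a != 0 ->
  exists b : 'rV[K]_n, b *m a = 1%:M /\ forall i j, Zintegral (a i 0 * b 0 j).
Proof.
move=> a0; pose f := \poly_(i < n) (if insub i is Some k then a k 0 else 0).
have fa (k : 'I_n) : f`_k = a k 0 by rewrite coef_poly ltn_ord valK.
have fE : f = \sum_(i < n) a i 0 *: 'X^i.
  by rewrite /f poly_def; apply: eq_bigr => i _; rewrite valK.
have f0 : f != 0.
  apply: contra_neq a0 => f0; apply/colP => k.
  by rewrite -fa f0 coef0 mxE.
have [g [q [q0 fgE]]] := poly_rat_multiple f0.
have [z [d d0 qz]] := rat_poly_scale q.
have [c [e [ce edvd]]] := bezout_seq z.
have e0 : e != 0.
  apply: contra_neq q0 => e0; rewrite qz; suff -> : z = 0 by rewrite rmorph0 scaler0.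
  by apply/polyP => i; have := edvd i; rewrite e0 dvd0z coef0 => /eqP.
have intK (m : int) : m != 0 -> (m%:~R : K) != 0.
  by rewrite -(rmorph_int (in_alg K)) fmorph_eq0 intr_eq0.
(* [d] clears the denominators of [q] and [e] is the gcd of the resulting coefficients, so [f * h]
   is [z] divided by its content. *)
pose h := (d%:~R / e%:~R) *: g.
have fh k : (f * h)`_k = (z`_k %/ e)%Z%:~R.
  rewrite -scalerAr coefZ fgE coef_map qz coefZ coef_map /= alg_num_field.
  have [t ->] := dvdzP (edvd k); rewrite mulzK //.
  rewrite -alg_num_field -[_%:A]/(in_alg K _) !rmorphM fmorphV !rmorph_int.
  by field; rewrite !intK.
have ah i j : Zintegral (f`_i * h`_j).
  pose s : {rmorphism K -> algC} := algRval \o sig (Ordinal (deg_gt0 E)).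
  apply/(integral_morph s); rewrite rmorphM -!(coef_map s).
  apply: integral_coef_mul => l; rewrite -rmorphM coef_map fh.
  by apply/integral_morph; exact: integral_id.
(* The Bezout combination of the coefficients of [f * h] equals [1]; the entry [j] collects what
   multiplies the coefficient [a j 0] of [f]. *)
exists (\row_j \sum_(k < size z) (c k)%:~R * ('X^j * h)`_k); split=> [|i j].
  apply/matrixP => i j; rewrite !ord1 !mxE eqxx.
  under eq_bigr do rewrite mxE mulr_suml.
  rewrite exchange_big /=.
  transitivity (\sum_(k < size z) (c k)%:~R * (f * h)`_k).
    apply: eq_bigr => k _; rewrite fE mulr_suml coef_sum mulr_sumr.
    apply: eq_bigr => l _; rewrite -scalerAl coefZ.
    by ring.
  under eq_bigr do rewrite fh.
  apply: (mulfI (intK e e0)); rewrite mulr1 -[in RHS]ce mulr_sumr rmorph_sum.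
  apply: eq_bigr => k _; rewrite -!rmorphM; congr (_ %:~R).
  by rewrite mulrCA [e * _]mulrC divzK.
rewrite !mxE mulr_sumr; apply: integral_sum => k _.
rewrite mulrCA; apply: integral_mul; first exact: integral_id.
rewrite -fa coefXnM; case: ifP => _; first by rewrite mulr0; exact: integral0.
exact: ah.
Qed.

(** The columns in [s] are linear functionals on row vectors, and [P] projects onto their common
    kernel. Each functional [b] with [P *m b != 0] is killed by a rank one correction, which is
    integral because [invertible_vector] is applied to [P *m b]. *)
Lemma integral_projection (n : nat) (s : seq 'cV[K]_n) : exists P : 'M[K]_n,
  [/\ forall i j, Zintegral (P i j), forall b, b \in s -> P *m b = 0
    & forall x : 'rV_n, (forall b, b \in s -> x *m b = 0) -> x *m P = x].
Proof.
elim: s => [|b s [P [PI Ps Px]]].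
  exists 1%:M; split=> // [i j|x _]; last by rewrite mulmx1.
  by rewrite mxE; exact: integral_nat.
have Px' (x : 'rV_n) : (forall b', b' \in b :: s -> x *m b' = 0) -> x *m P = x.
  by move=> xb; apply: Px => c cs; apply: xb; rewrite inE cs orbT.
have [Pb|Pb] := eqVneq (P *m b) 0.
  exists P; split=> // c; rewrite inE => /orP [/eqP ->//|]; exact: Ps.
have [c [cE cI]] := invertible_vector Pb.
exists (P - (P *m b) *m c *m P); split=> [i j|d|x xb].
- rewrite mxE [X in _ + X]mxE; apply: integral_sub => //; rewrite mxE.
  apply: integral_sum => k _; apply: integral_mul => //.
  by rewrite mxE big_ord1.
- rewrite inE mulmxBl => /orP [/eqP ->|ds]; last first.
    by rewrite -!mulmxA (Ps _ ds) !mulmx0 subrr.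
  have -> : P *m b *m c *m P *m b = P *m b *m (c *m (P *m b)) by rewrite !mulmxA.
  by rewrite cE mulmx1 subrr.
rewrite mulmxBr (Px' x xb) !mulmxA (Px' x xb) xb ?mem_head //.
by rewrite !mul0mx subr0.
Qed.

End InvertibleIdeals.

(** * Free covers *)

Section Pullback.
Variables (K : fieldExtType rat) (M : lattice K) (V : lmodType 'O_K).
Variable phi : {linear V -> M}.
Hypotheses (phi_inj : injective phi) (V_fg : finitely_generated V).

Definition pull_form (v : V) : 'O_K := lat_form (phi v).

Lemma pull_polarE v w :
  polar pull_form v w = polar (@lat_form _ M) (phi v) (phi w).
Proof. by rewrite /polar /pull_form raddfD. Qed.

Lemma pull_tf : torsion_free V.
Proof.
move=> a v /(congr1 phi); rewrite linearZ linear0 => /lat_tf [|v0]; first by left.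
by right; apply: phi_inj; rewrite linear0.
Qed.

Lemma pull_formZ (a : 'O_K) (v : V) : pull_form (a *: v) = a ^+ 2 * pull_form v.
Proof. by rewrite /pull_form linearZ lat_formZ. Qed.

Lemma pull_polarl (a : 'O_K) (u v w : V) :
  polar pull_form (a *: u + v) w
    = val a * polar pull_form u w + polar pull_form v w.
Proof. by rewrite !pull_polarE linearP lat_polarl. Qed.

Lemma pull_polarr (a : 'O_K) (u v w : V) :
  polar pull_form w (a *: u + v)
    = val a * polar pull_form w u + polar pull_form w v.
Proof. by rewrite !pull_polarE linearP lat_polarr. Qed.

Lemma pull_pos (v : V) : v != 0 -> pos_integers (pull_form v).
Proof.
by move=> v0; apply: lat_pos; apply: contra_neq v0 => pv; apply: phi_inj;
  rewrite linear0.
Qed.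

Definition pull_lattice : lattice K :=
  Lattice V_fg pull_tf pull_formZ pull_polarl pull_polarr pull_pos.

End Pullback.

Section FreeCover.
Variables (K : fieldExtType rat) (E : embedding_data K).
Local Notation emb := (@emb K E).
Local Notation norm := (@norm K E).

Lemma nat_pos (N : nat) : (0 < N)%N -> @pos_integers K N%:R.
Proof. by move=> N0; apply/(pos_integersP E) => i; rewrite rmorph_nat ltr0n. Qed.

Lemma integral_map_mx (m n : nat) (A : 'M[K]_(m, n)) :
  (forall i j, Zintegral (A i j)) -> exists B : 'M['O_K]_(m, n), A = map_mx val B.
Proof.
move=> AI; have AI' i j : @integral_pred K (A i j) by apply/asboolP; exact: AI.
by exists (\matrix_(i, j) Integer (AI' i j)); apply/matrixP => i j; rewrite !mxE.
Qed.

Lemma int_mx_inj (m n : nat) (A B : 'M['O_K]_(m, n)) :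
  map_mx val A = map_mx val B :> 'M[K]_(m, n) -> A = B.
Proof.
move=> /matrixP AB; apply/matrixP => i j; apply: val_inj.
by have := AB i j; rewrite !mxE.
Qed.

Lemma common_denominator (n : nat) (x : 'rV[K]_n) :
  exists2 D : nat, (0 < D)%N & exists y : 'rV['O_K]_n, D%:R *: x = map_mx val y.
Proof.
have /fin_all_exists2 [m m0 mI] (k : 'I_n) := integral_multiple (x 0 k).
exists (\prod_k m k)%N; first exact: prodn_gt0.
apply: integral_map_mx => i j; rewrite ord1 mxE (bigD1 j) //= natrM mulrAC mulrC.
apply: integral_mul; last exact: mI.
exact: integral_nat.
Qed.

(** Relations of maximal rank span all relations over [K]. Conversely, an integral vector in their
    span becomes a relation after multiplication by a positive integer, and torsion-freeness removes
    this factor. The functionals are the columns of a cokernel matrix. *)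
Lemma kernel_functionals (L : lattice K) (n : nat) (e : 'I_n -> L) :
  exists s : seq 'cV[K]_n, forall c : 'rV['O_K]_n,
    \sum_i c 0 i *: e i = 0 <-> forall b, b \in s -> map_mx val c *m b = 0.
Proof.
pose ker (c : 'rV['O_K]_n) := \sum_i c 0 i *: e i = 0.
pose good r := `[< exists (m : nat) (A : 'M['O_K]_(m, n)),
  (forall i, ker (row i A)) /\ \rank (map_mx val A : 'M[K]_(m, n)) = r >].
have : exists r, good r.
  by exists (\rank (map_mx val (0 : 'M['O_K]_(0, n)) : 'M[K]_(0, n))); apply/asboolP;
    exists 0, 0; split=> // -[].
have goodn r : good r -> (r <= n)%N.
  by move=> /asboolP [m [A [_ <-]]]; exact: rank_leq_col.
move=> ex; case: (ex_maxnP ex goodn) => r /asboolP [m [A [Aker Ar]]] rmax.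
set AK : 'M[K]_(m, n) := map_mx val A in Ar.
exists [seq col j (cokermx AK) | j <- enum 'I_n] => c.
have cE : (forall b, b \in [seq col j (cokermx AK) | j <- enum 'I_n] ->
    map_mx val c *m b = 0) <-> (map_mx val c <= AK)%MS.
  split=> [H|].
    rewrite submxE; apply/eqP/rowP => j.
    have /H/matrixP/(_ 0 0) : col j (cokermx AK) \in [seq col j (cokermx AK) | j <- enum 'I_n].
      by apply: map_f; rewrite mem_enum.
    by rewrite !mxE => Hj; rewrite -[RHS]Hj; apply: eq_bigr => k _; rewrite [col _ _ _ _]mxE.
  rewrite submxE => /eqP H b /mapP [j _ ->].
  by rewrite !colE mulmxA H mul0mx.
apply: iff_trans (iff_sym cE); split=> [kc|].
  have : (\rank (col_mx AK (map_mx val c)) <= r)%N.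
    apply: rmax; apply/asboolP; exists (m + 1)%N, (col_mx A c).
    split; last by rewrite map_col_mx.
    move=> i; case: (splitP i) => j ij.
      have -> : i = lshift 1 j by exact: val_inj.
      by rewrite rowKu.
    have -> : i = rshift m j by exact: val_inj.
    by rewrite rowKd ord1 row_id.
  rewrite -Ar -addsmxE => rk.
  have [le eqv] := mxrank_leqif_sup (addsmxSl AK (map_mx val c)).
  apply: submx_trans (addsmxSr AK _) _.
  by rewrite -eqv eqn_leq le rk.
case/submxP => lam lamE.
have [D D0 [y yE]] := common_denominator lam.
have DcE : D%:R *: c = y *m A.
  apply: int_mx_inj.
  rewrite map_mxM -yE map_mxZ lamE scalemxAl rmorph_nat.
  by [].
have kD : ker (D%:R *: c).
  rewrite DcE /ker; under eq_bigr do rewrite mxE scaler_suml.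
  rewrite exchange_big big1 //= => k _.
  under eq_bigr do rewrite -scalerA.
  rewrite -scaler_sumr; have := Aker k; rewrite /ker.
  under eq_bigr do rewrite mxE.
  by move=> ->; rewrite scaler0.
have : D%:R *: (\sum_i c 0 i *: e i) = 0.
  rewrite -[RHS]kD scaler_sumr; apply: eq_bigr => i _.
  by rewrite mxE scalerA.
case/lat_tf => // /eqP.
rewrite -(emb_eq0 (Ordinal (deg_gt0 E))) rmorph_nat pnatr_eq0.
by rewrite -leqn0 leqNgt D0.
Qed.

Lemma free_cover (L : lattice K) (N : nat) : (0 < N)%N -> exists L' : lattice K,
  [/\ free_lattice L', classical_lattice L -> classical_lattice L',
    forall x, represents L x -> represents L' x &
    exists2 s : seq 'O_K, forall a, a \in s -> a = N%:R &
      forall x, represents L' x -> exists v y,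
        [/\ represents L v, diag_rep s y & x = v + y]].
Proof.
move=> N0; have [n [e eP]] := @lat_fg _ L.
have [s sP] := kernel_functionals e.
have [PK [PI Ps Px]] := integral_projection E s.
have [P PE] := integral_map_mx PI.
pose p (c : 'rV['O_K]_n) := \sum_i c 0 i *: e i.
have pP c : p (c *m P) = 0.
  apply/sP => b bs; rewrite map_mxM -PE -mulmxA Ps // mulmx0.
  by [].
have pid c : p c = 0 -> c *m P = c.
  move/sP => H; apply: int_mx_inj.
  by rewrite map_mxM -PE; exact: Px.
have pL : linear p.
  move=> a u v; rewrite /p scaler_sumr -big_split; apply: eq_bigr => i _.
  by rewrite !mxE scalerDl scalerA.
have pB u v : p (u - v) = p u - p v.
  by rewrite [u - v]addrC -[- v]scaleN1r pL scaleN1r addrC.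
pose M := ortho_lattice L (diag_lattice (fun _ : 'I_n => nat_pos N0)).
(* The free module embeds into the orthogonal sum of [L] and [<N, ..., N>]: a vector with [p c = 0]
   satisfies [c *m P = c], so it vanishes once its second component does. The new form is the
   pullback. *)
pose phi (c : 'rV['O_K]_n) : M := (p c, c *m P).
have phiL : linear phi.
  by move=> a u v; rewrite /phi pL mulmxDl -scalemxAl.
pose phi' : {linear 'rV['O_K]_n -> M} :=
  HB.pack phi (GRing.isLinear.Build 'O_K 'rV['O_K]_n M *:%R phi phiL).
have phi_inj : injective phi'.
  move=> c d [pcd cdP]; apply/eqP; rewrite -subr_eq0; apply/eqP.
  rewrite -[LHS]pid; first by rewrite mulmxBl cdP subrr.
  by rewrite pB pcd subrr.
exists (pull_lattice phi_inj (@diag_fg K n)); split.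
- exact: rV_free.
- move=> cL v w; rewrite pull_polarE; apply: classical_ortho => //.
  by move=> *; exact: diag_form_integral.
(* This lift of [v] has second component zero, since [P] fixes [c *m P]. *)
- move=> _ [v ->]; have [c ->] := eP v; exists (c - c *m P).
  rewrite /= /pull_form /= /ortho_form /=.
  have cP0 : (c - c *m P) *m P = 0 by rewrite mulmxBl (pid _ (pP c)) subrr.
  rewrite cP0 pB pP subr0.
  rewrite [X in _ + X](_ : _ = 0) ?addr0 // /diag_form big1 // => i _.
  by rewrite mxE expr0n mulr0.
exists (flatten [seq [:: N%:R] | i <- enum 'I_n]).
  by move=> a /flattenP [l /mapP [i _ ->]]; rewrite inE => /eqP.
move=> _ [c ->]; exists (lat_form (p c)), (diag_form (fun=> N%:R) (c *m P)).
split=> //; first by exists (p c).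
rewrite /diag_form -big_enum; apply: (@diag_rep_sum K _ _ (fun=> [:: N%:R])) => i.
exact: diag_rep1.
Qed.

(** The free cover is taken with [N = norm a + 1]. A representation of [a] that is new to the cover
    would involve a nonzero term [N * c ^+ 2] bounded by [a], whose norm exceeds [norm a]. *)
Lemma truant_free (P P' : lattice K -> Prop) a :
  (forall L L' : lattice K, P L -> free_lattice L' ->
    (classical_lattice L -> classical_lattice L') -> P' L') ->
  truant P a -> truant P' a.
Proof.
move=> PP' [aP [L [PL La Lo]]]; have [n n0 nE] := pos_norm E aP.
have [L' [L'f L'c L'L [s sN L'E]]] := free_cover L (ltn0Sn n).
split=> //; exists L'; split=> [||b bP nab]; last by apply/L'L/Lo.
  exact: PP' L'f L'c.
case/L'E => v [y [Lv sy aE]].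
have sP c : c \in s -> pos_integers c by move=> /sN ->; exact: nat_pos.
have y0 : y != 0.
  by apply: contra_notN La => /eqP y0; rewrite aE y0 addr0.
have [b [c [bs c0 bc]]] := diag_rep_term E sP sy y0.
have bP := sP b bs.
have bcP : pos_integers (b * c ^+ 2).
  apply/(pos_integersP E) => i; rewrite emb_mulsq mulr_gt0 ?pos_emb //.
  by rewrite lt_def expf_neq0 ?emb_eq0 // sqr_ge0.
have [le _] : norm (b * c ^+ 2) <= norm a ?= iff (b * c ^+ 2 == a).
  apply: norm_le => // i; rewrite aE embD; case: Lv => w ->.
  by rewrite (le_trans (bc i)) // lerDr lat_form_ge0.
have := le_trans (norm_sqM_ge E bP c0) le; rewrite nE (sN b bs).
apply/negP; rewrite -ltNge /norm.
apply: (@lt_le_trans _ _ n.+1%:R); first by rewrite ltr_nat.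
under eq_bigr do rewrite rmorph_nat.
rewrite prodr_const card_ord -natrX ler_nat -[leqLHS]expn1.
by rewrite leq_pexp2l // deg_gt0.
Qed.

End FreeCover.

(** * Invariance and conclusion *)

Section Invariance.
Variable K : fieldExtType rat.
Implicit Types (P : lattice K -> Prop) (L : lattice K).

Lemma truant_sub P P' a : (forall L, P L -> P' L) -> truant P a -> truant P' a.
Proof. by move=> PP' [aP [L [PL La Lo]]]; split=> //; exists L; split=> //; exact: PP'. Qed.

Lemma truant_classes_sub P P' : (forall a, truant P a -> truant P' a) ->
  truant_classes P `<=` truant_classes P'.
Proof. by move=> PP' _ [a /PP' aT <-]; exists a. Qed.

(** Stated through represented values so that it also applies to diagonal lattices, whose image has
    to be rebuilt as a [diag_lattice]. *)
Definition transported P (f : 'O_K -> 'O_K) := forall L, P L ->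
  exists2 L', P L' & forall x, represents L' (f x) <-> represents L x.

Lemma truant_map P (f g : 'O_K -> 'O_K) a : cancel g f ->
  (forall x, pos_integers x -> pos_integers (f x)) ->
  (forall x, pos_integers x -> pos_integers (g x)) ->
  (forall x y, sq_class x y -> sq_class (f x) (f y)) ->
  transported P f -> truant P a -> truant P (f a).
Proof.
move=> gK fP gP fC Pf [aP [L [PL La Lo]]]; split; first exact: fP.
have [L' PL' L'E] := Pf L PL; exists L'; split=> // [/L'E //|b bP nab].
rewrite -[b]gK; apply/L'E/Lo; first exact: gP.
by move=> /fC; rewrite gK.
Qed.

(** The left side is the common shape of [gal_classes] and [mul_classes], so both invariances are
    instances. *)
Lemma image_truant_classes P (f g : 'O_K -> 'O_K) :
  cancel f g -> cancel g f ->
  (forall x, pos_integers x -> pos_integers (f x)) ->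
  (forall x, pos_integers x -> pos_integers (g x)) ->
  (forall x y, sq_class x y -> sq_class (f x) (f y)) ->
  (forall x y, sq_class x y -> sq_class (g x) (g y)) ->
  transported P f -> transported P g ->
  [set sq_class (f a) | a in
    [set a | pos_integers a /\ truant_classes P (sq_class a)]]
  = truant_classes P.
Proof.
move=> fK gK fP gP fC gC Pf Pg; apply/seteqP; split=> [_ [a [aP aT] <-]|_ [a aT <-]].
  exists (f a) => //; apply: (truant_map gK) => //.
  exact/truant_classesP.
have gaT : truant P (g a) by exact: (truant_map fK).
have gaP : pos_integers (g a) by case: gaT.
by exists (g a); rewrite ?gK //=; split=> //; exact/truant_classesP.
Qed.

Lemma integers_map_unit (s : {rmorphism K -> K}) (u : 'O_K) :
  u \is a GRing.unit -> integers_map s u \is a GRing.unit.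
Proof. exact: rmorph_unit. Qed.

Lemma integers_map_class (s : {rmorphism K -> K}) (x y : 'O_K) :
  sq_class x y -> sq_class (integers_map s x) (integers_map s y).
Proof.
case=> u uU ->; exists (integers_map s u); first exact: integers_map_unit.
by rewrite rmorphM rmorphXn.
Qed.

Definition twist_closed P := forall s r : {rmorphism K -> K},
  cancel s r -> cancel r s -> transported P (integers_map s).

Definition scale_closed P := forall e : 'O_K, e \is a GRing.unit ->
  pos_integers e -> transported P ( *%R e).

Lemma inverse_rmorph (s : {rmorphism K -> K}) : bijective s ->
  exists r : {rmorphism K -> K}, cancel s r /\ cancel r s.
Proof.
case=> r sK rK.
have rA := can2_zmod_morphism sK rK.
have rM := can2_monoid_morphism sK rK.
pose hA := GRing.isZmodMorphism.Build K K r rA.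
pose hM := GRing.isMonoidMorphism.Build K K r rM.
by exists (HB.pack r hA hM : {rmorphism K -> K}).
Qed.

Lemma invariant_truant_classes P : twist_closed P -> scale_closed P ->
  forall (s : {rmorphism K -> K}) (e : 'O_K),
  bijective s -> e \is a GRing.unit -> totally_positive (val e) ->
  gal_classes s (truant_classes P) = truant_classes P /\
  mul_classes e (truant_classes P) = truant_classes P.
Proof.
move=> Pt Ps s e sB eU eP; split.
  have [r [sK rK]] := inverse_rmorph sB.
  apply: (@image_truant_classes P _ (integers_map r)).
  - exact: integers_mapK.
  - exact: integers_mapK.
  - exact: integers_map_pos.
  - exact: integers_map_pos.
  - exact: integers_map_class.
  - exact: integers_map_class.
  - exact: Pt sK rK.
  - exact: Pt rK sK.
have mulC (c x y : 'O_K) : sq_class x y -> sq_class (c * x) (c * y).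
  by case=> u uU ->; exists u => //; rewrite mulrA.
have e'P : pos_integers e^-1.
  move=> t tR; have e0 : 0 < t (val e) by exact: eP.
  have : t (val e) * t (val e^-1) = 1.
    by rewrite -rmorphM -[X in t X](rmorphM val) divrr // !rmorph1.
  by move=> H; rewrite -(pmulr_rgt0 _ e0) H ltr01.
apply: (@image_truant_classes P _ ( *%R e^-1)).
- exact: mulKr.
- exact: mulVKr.
- by move=> x; exact: pos_integersM.
- by move=> x; exact: pos_integersM.
- exact: mulC.
- exact: mulC.
- exact: Ps.
- by apply: Ps => //; rewrite unitrV.
Qed.

Lemma twist_transported P : (forall s r sK rK L, P L ->
  P (@twist_lattice K s r sK rK L)) -> twist_closed P.
Proof.
move=> PT s r sK rK L PL; exists (twist_lattice sK rK L); first exact: PT.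
by move=> x; split; [exact: twist_represents_inv | exact: twist_represents].
Qed.

Lemma scale_transported P : (forall L (e : 'O_K) (eP : pos_integers e), P L ->
  P (scale_lattice L eP)) -> scale_closed P.
Proof.
move=> PS e eU eP L PL; exists (scale_lattice L eP); first exact: PS.
move=> x; split; last exact: scale_represents.
by case=> v /(mulrI eU) ->; exists v.
Qed.

Lemma scale_classical L (e : 'O_K) (eP : pos_integers e) :
  classical_lattice L -> classical_lattice (scale_lattice L eP).
Proof.
move=> cL v w; rewrite -[polar _ _ _]/(polar (@scale_form _ L e) v w).
by rewrite scale_polarE rpredM //; [exact: int_valP | exact: cL].
Qed.

Lemma twist_closed_diagonal : twist_closed (@diagonal_lattice K).
Proof.
move=> s r sK rK _ [n [a [aP ->]]].
have bP i : pos_integers (integers_map s (a i)) by exact: integers_map_pos.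
exists (diag_lattice bP); first by exists n, (fun i => integers_map s (a i)), bP.
have fE c : diag_form (fun i => integers_map s (a i)) (map_mx (integers_map s) c) =
    integers_map s (diag_form a c).
  rewrite /diag_form rmorph_sum; apply: eq_bigr => i _.
  by rewrite mxE rmorphM rmorphXn.
move=> x; split=> [[c cE]|[c ->]]; last by exists (map_mx (integers_map s) c); rewrite /= fE.
exists (map_mx (integers_map r) c).
apply: (can_inj (integers_mapK sK)); rewrite cE /= -fE; congr diag_form.
by apply/rowP => i; rewrite !mxE (integers_mapK rK).
Qed.

Lemma scale_closed_diagonal : scale_closed (@diagonal_lattice K).
Proof.
move=> e eU eP _ [n [a [aP ->]]].
have bP i : pos_integers (e * a i) by exact: pos_integersM.
exists (diag_lattice bP); first by exists n, (fun i => e * a i), bP.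
have fE c : diag_form (fun i => e * a i) c = e * diag_form a c.
  by rewrite /diag_form mulr_sumr; apply: eq_bigr => i _; rewrite mulrA.
move=> x; split=> [[c]|[c ->]]; last by exists c; rewrite /= fE.
by rewrite /= fE => /(mulrI eU) ->; exists c.
Qed.

End Invariance.

Theorem theorem1p2 (K : fieldExtType rat) (hK : totally_real K) :
  exists Cdiag Cclfr Ccl Cfr Call : set (set 'O_K),
    [/\ unique (minimal_criterion_set (@diagonal_lattice K)) Cdiag,
        unique (minimal_criterion_set (@classical_free_lattice K)) Cclfr,
        unique (minimal_criterion_set (@classical_lattice K)) Ccl,
        unique (minimal_criterion_set (@free_lattice K)) Cfr
      & unique (minimal_criterion_set (@any_lattice K)) Call] /\
    [/\ Cdiag `<=` Cclfr, Cclfr = Ccl, Ccl `<=` Cfr & Cfr = Call] /\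
    (forall C : set (set 'O_K), [set Cdiag; Cclfr; Ccl; Cfr; Call] C ->
     forall (s : {rmorphism K -> K}) (e : 'O_K),
       bijective s -> e \is a GRing.unit -> totally_positive (val e) ->
       gal_classes s C = C /\ mul_classes e C = C).
Proof.
have [E] := embedding_data_exists hK.
exists (truant_classes (@diagonal_lattice K)),
  (truant_classes (@classical_free_lattice K)),
  (truant_classes (@classical_lattice K)),
  (truant_classes (@free_lattice K)), (truant_classes (@any_lattice K)).
(* A smaller class of lattices has fewer truants, which gives one inclusion; free covers, which stay
   classical, give the other. *)
have clfr_cl : truant_classes (@classical_free_lattice K) =
    truant_classes (@classical_lattice K).
  apply/seteqP; split; apply: truant_classes_sub => a.
    by apply: truant_sub => L [].
  by apply: (truant_free E) => L L' cL fL' /(_ cL).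
have fr_all : truant_classes (@free_lattice K) = truant_classes (@any_lattice K).
  apply/seteqP; split; apply: truant_classes_sub => a.
    by apply: truant_sub.
  by apply: (truant_free E).
split; last split; [split; apply: (truant_unique E)|split=> //|].
- exact: extensible_diagonal.
- exact: extensible_classical_free.
- exact: extensible_classical.
- exact: extensible_free.
- exact: extensible_any.
- apply: truant_classes_sub => a; apply: truant_sub; exact: diag_classical_free.
(* The free cover of the classical lattice that witnesses a truant is a free lattice witnessing
   it. *)
- by apply: truant_classes_sub => a; apply: (truant_free E).
move=> C [[[[->|->]|->]|->]|->]; apply: invariant_truant_classes.
- exact: twist_closed_diagonal.
- exact: scale_closed_diagonal.
- apply: twist_transported => s r sK rK L [cL fL].
  by split; [exact: twist_classical | exact: twist_free].
- apply: scale_transported => L e eP [cL fL].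
  by split; [exact: scale_classical | exact: fL].
- by apply: twist_transported => *; exact: twist_classical.
- by apply: scale_transported => *; exact: scale_classical.
- by apply: twist_transported => *; exact: twist_free.
- by apply: scale_transported.
- by apply: twist_transported.
- by apply: scale_transported.
Qed.
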